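(* Let $\zeta_5=e^{2\pi i/5}$ and $Y(t)=t\,\frac{1-2t+4t^2-3t^3+t^4}{1+3t+4t^2+2t^3+t^4}$. Then for all $u\in\mathbb{C}$ with $0<|u|$ sufficiently small, \[r(u^5)=\sum_{j=0}^{4} r\!\left(Y(\zeta_5^j u)\right).\]
   Context: $r(t)=\mathrm{m}\!\left((x+y+1)(x+1)(y+1)-\frac1t xy\right)$, where $\mathrm{m}(P)=\int_0^1\int_0^1\log|P(e^{2\pi i\theta_1},e^{2\pi i\theta_2})|d\theta_1d\theta_2$ is the logarithmic Mahler measure. *)

(* Defs.v *)
From mathcomp Require Import all_boot all_algebra.
From mathcomp Require Import all_classical all_reals all_analysis.
From mathcomp Require Export complex.
Import GRing.Theory Num.Theory.
Local Open Scope ring_scope.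
Local Open Scope complex_scope.

Set Implicit Arguments.
Unset Strict Implicit.
Unset Printing Implicit Defensive.

Definition expi2pi (R : realType) (theta : R) : R[i] :=
  (cos (2 * pi * theta)) +i* (sin (2 * pi * theta)).

Definition mahler2 (R : realType) (P : R[i] -> R[i] -> R[i]) : R :=
  Rintegral (@lebesgue_measure R) `[0%R, 1%R]%classic (fun th1 : R =>
    Rintegral (@lebesgue_measure R) `[0%R, 1%R]%classic (fun th2 : R =>
      ln (Normc.normc (P (expi2pi th1) (expi2pi th2))))).

Definition r (R : realType) (t : R[i]) : R :=
  mahler2 (fun x y : R[i] => (x + y + 1) * (x + 1) * (y + 1) - t^-1 * x * y).

Definition zeta5 (R : realType) : R[i] := expi2pi (1 / 5%:R : R).

Definition Yfun (R : realType) (t : R[i]) : R[i] :=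
  t * (1 - 2%:R * t + 4%:R * t ^+ 2 - 3%:R * t ^+ 3 + t ^+ 4)
    / (1 + 3%:R * t + 4%:R * t ^+ 2 + 2%:R * t ^+ 3 + t ^+ 4).

(* Main.v *)
(** For small t, expanding log|1 - t k| with k = (x + y + 1)(x + 1)(y + 1)/(x y)
    gives r(t) = - log|t| - Re G(t), where G(t) = sum_(n >= 1) a_n t^n / n and a_n
    is the constant term of k^n, i.e. the Apéry number sum_k C(n,k)^2 C(n+k,k).
    Write Y = X U / D, A = 1 - X - X^2, p = 1 - 11 X^5 - X^10 = A U D, theta = X d/dX
    and F = sum_n a_n X^n = 1 + theta G. Apéry's recurrence says that F solves a
    second-order equation with a double exponent 0 at the origin; F(Y) and D F(X^5)
    then solve one and the same such equation, so F(Y) = D F(X^5).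
    Hence P = G(Y) + log(U / D) - G(X^5) / 5 satisfies
    p theta P = F(X^5) (A^5 D - p), and A^5 D - p has no exponent divisible by 5,
    so neither has P: summing P over the five points zeta^j u gives 0, which is the
    theorem.

    All series are truncated at order n, identities hold modulo X^n, and every
    error is at most a constant times 2^-n, so no convergence theory is needed. *)
Require Import Defs.
From mathcomp Require Import all_boot all_order all_algebra.
From mathcomp Require Import all_classical all_reals all_analysis.
From mathcomp Require Import complex.
From mathcomp Require Import ring lra zify.
Import Order.TTheory GRing.Theory Num.Theory.
Import numFieldNormedType.Exports.
Set Implicit Arguments.
Unset Strict Implicit.
Unset Printing Implicit Defensive.
Local Open Scope ring_scope.

(** * Truncated power series *)

Section Formal.
Variable K : numFieldType.
Implicit Types (p q f g r a b c S T W : {poly K}) (n : nat).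

Definition eqX n p q := forall i, (i < n)%N -> p`_i = q`_i.

Lemma eqX_refl n p : eqX n p p. Proof. by []. Qed.

Lemma eqX_sym n p q : eqX n p q -> eqX n q p.
Proof. by move=> h i /h ->. Qed.

Lemma eqX_trans n q p r : eqX n p q -> eqX n q r -> eqX n p r.
Proof. by move=> h k i i_n; rewrite h // k. Qed.

Lemma eqXD n p q p' q' : eqX n p q -> eqX n p' q' -> eqX n (p + p') (q + q').
Proof. by move=> h k i i_n; rewrite !coefD h // k. Qed.

Lemma eqXM n p q p' q' : eqX n p q -> eqX n p' q' -> eqX n (p * p') (q * q').
Proof.
move=> h k i i_n; rewrite !coefM; apply: eq_bigr => -[j /= j_i] _.
by rewrite h ?k //; lia.
Qed.

Lemma eqXMl n r p q : eqX n p q -> eqX n (r * p) (r * q).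
Proof. exact: eqXM (eqX_refl r). Qed.

Lemma eqXMr n r p q : eqX n p q -> eqX n (p * r) (q * r).
Proof. by move=> h; apply: eqXM h (eqX_refl r). Qed.

(* Congruences are applied by exhibiting the cofactor [c], so that [ring] does the rest. *)
Lemma eqX_cofactor n a b c p q : eqX n a b -> p - q = (a - b) * c -> eqX n p q.
Proof.
move=> h e; have {e}-> : p = q + (a - b) * c by rewrite -e; ring.
rewrite -[X in eqX _ _ X]addr0; apply: eqXD => //.
rewrite -[X in eqX _ _ X](mul0r c); apply: eqXMr => i i_n.
by rewrite coefB h // subrr coef0.
Qed.

Lemma eqX_exp0 n m p : p`_0 = 0 -> (n <= m)%N -> eqX n (p ^+ m) 0.
Proof.
move=> p0; elim: n m => [|n IH] // [//|m] n_m i i_n.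
rewrite exprS coefM coef0 big1 // => -[[|j] /= j_i] _; first by rewrite p0 mul0r.
by rewrite (IH m) ?coef0 ?mulr0 //; lia.
Qed.

(** Terms of index at least [n] contribute multiples of [f ^+ n], which vanish modulo X^n because
    [f] has no constant term. *)
Lemma eqX_comp n p q f : f`_0 = 0 -> eqX n p q -> eqX n (p \Po f) (q \Po f).
Proof.
move=> f0 h; suff: eqX n ((p - q) \Po f) 0.
  move=> k; rewrite -[p](subrK q) comp_polyD -[X in eqX _ _ X]add0r.
  exact: eqXD.
have {}h i : (i < n)%N -> (p - q)`_i = 0 by move=> i_n; rewrite coefB h // subrr.
rewrite comp_polyE => j j_n; rewrite coef_sum coef0 big1 // => i _.
have [/h->|n_i] := ltnP i n; first by rewrite scale0r coef0.
by rewrite coefZ (eqX_exp0 f0 n_i) ?coef0 ?mulr0.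
Qed.

(** The Euler operator acts diagonally on monomials, so unlike the derivative it loses no order of a
    congruence modulo X^n. *)
Definition theta p := 'X * p^`().

Lemma coef_theta p i : (theta p)`_i = p`_i *+ i.
Proof. by rewrite coefXM coef_deriv; case: i. Qed.

Lemma thetaM p q : theta (p * q) = theta p * q + p * theta q.
Proof. by rewrite /theta derivM; ring. Qed.

Lemma thetaD p q : theta (p + q) = theta p + theta q.
Proof. by rewrite /theta derivD mulrDr. Qed.

Lemma thetaB p q : theta (p - q) = theta p - theta q.
Proof. by rewrite /theta derivB mulrBr. Qed.

Lemma theta_comp p f : theta (p \Po f) = theta f * (p^`() \Po f).
Proof. by rewrite /theta deriv_comp; ring. Qed.

Lemma theta_Xn n : theta 'X^n = n%:R * 'X^n.
Proof.
case: n => [|n]; first by rewrite /theta derivC mulr0 mul0r.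
by rewrite /theta poly.derivXn -mulr_natl mulrCA -exprS.
Qed.

Lemma eqX_theta n p q : eqX n p q -> eqX n (theta p) (theta q).
Proof. by move=> h i i_n; rewrite !coef_theta h. Qed.

(* The double exponent 0 at the origin leaves a solution determined by its constant term. *)
Lemma eqX_ode_unique n S T W : S`_0 = 1 -> W`_0 = 0 ->
  eqX n (theta (S * theta W)) ('X * T * W) -> eqX n W 0.
Proof.
move=> S0 W0 h; elim/ltn_ind=> -[|i] IH i_n; first by rewrite W0 coef0.
have := h _ i_n; rewrite coef_theta coefMr big_ord_recr /= subnn S0 mul1r.
rewrite big1 ?add0r => [|[j /= j_i] _]; last first.
  by rewrite coef_theta (IH j) ?coef0 ?mul0rn ?mulr0 //; lia.
rewrite coef_theta -mulrnA -mulrA coefXM /= coefMr big1 => [/eqP|[j /= j_i] _].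
  by rewrite mulrn_eq0 muln_eq0 /= => /eqP ->; rewrite coef0.
by rewrite (IH j) ?coef0 ?mulr0 //; lia.
Qed.

Definition polU : {poly K} := 1 - 2%:R * 'X + 4%:R * 'X^2 - 3%:R * 'X^3 + 'X^4.
Definition polD : {poly K} := 1 + 3%:R * 'X + 4%:R * 'X^2 + 2%:R * 'X^3 + 'X^4.
Definition polA : {poly K} := 1 - 'X - 'X^2.
(** Leading coefficient of Apéry's operator: the equation for F reads theta (w theta F) = X (3 + X)
    F. The polynomial p of the overview is [polw] at X^5. *)
Definition polw : {poly K} := 1 - 11%:R * 'X - 'X^2.

Lemma comp_poly_natr m f : (m%:R : {poly K}) \Po f = m%:R.
Proof. by rewrite -polyC_natr comp_polyC. Qed.

Definition comp_poly_simp :=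
  (comp_polyB, comp_polyD, comp_polyM, comp_Xn_poly, comp_polyX, comp_poly_natr,
   comp_polyC).

Lemma polAUD : polA * polU * polD = polw \Po 'X^5.
Proof.
rewrite /polw !comp_poly_simp.
rewrite /polA /polU /polD; ring.
Qed.

(** The left side is D^2 w(X U / D), so that w(Y) = A^5 / D^2. *)
Lemma polw_homog : polD ^+ 2 - 11%:R * 'X * polU * polD - 'X^2 * polU ^+ 2 = polA ^+ 5.
Proof. rewrite /polA /polU /polD; ring. Qed.

(** The left side is the numerator, divided by X, in the quotient rule for X U / D; hence theta Y =
    X A^4 / D^2. *)
Lemma theta_polY_num :
  polU * polD + polD * theta polU - polU * theta polD = polA ^+ 4.
Proof. rewrite /theta /polA /polU /polD !poly.derivE; ring. Qed.

(** Compares the terms without derivative of F in the equations that F(Y) and D F(X^5) must share.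
    The factor 25 comes from applying theta twice to a series in X^5. *)
Lemma ode_transfer :
  25%:R * (3%:R * 'X^5 + 'X^10) * polD
   + polD * theta (polA * polU * theta polD) - polA * polU * theta polD ^+ 2
  = polA ^+ 4 * 'X * (3%:R * polD + 'X * polU).
Proof.
have -> : theta polD = 3%:R * 'X + 8%:R * 'X^2 + 6%:R * 'X^3 + 4%:R * 'X^4.
  by rewrite /theta /polD !poly.derivE; ring.
rewrite !thetaM !thetaD !thetaM.
rewrite /theta /polA /polU /polD !poly.derivE; ring.
Qed.

End Formal.

(** * The modular equation *)

Section ModularEquation.
Variables (K : numFieldType) (n : nat) (E F : {poly K}).
Hypothesis n_gt0 : (0 < n)%N.
Local Notation A := (polA K).
Local Notation U := (polU K).
Local Notation D := (polD K).
Local Notation w := (polw K).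
Local Notation "p =X q" := (eqX n p q) (at level 70).
Hypothesis DE : D * E =X 1.
Hypothesis odeF : ('X * w * F^`())^`() =X (3%:R + 'X) * F.
Let Y := 'X * U * E.

Let Y0 : Y`_0 = 0. Proof. by rewrite /Y -mulrA coefXM. Qed.

Let D0 : D`_0 = 1.
Proof. by rewrite /polD -horner_coef0 !hornerE /=; ring. Qed.

Lemma inverse_coef0 : E`_0 = 1.
Proof. by have := DE n_gt0; rewrite coefM big_ord1 subn0 coef1 D0 mul1r. Qed.

(** Follows from theta (D E) = 0. As D E = 1 holds only modulo X^n, factors D E are inserted and
    removed as congruences. *)
Let thetaE : theta E =X - (E ^+ 2 * theta D).
Proof.
have h : theta (D * E) =X 0.
  move=> i i_n; rewrite coef_theta DE // coef1 coef0.
  by case: i i_n => //= i _; rewrite mul0rn.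
have h1 : theta E =X D * E * theta E.
  by apply: (eqX_cofactor (c := - theta E) DE); ring.
apply: eqX_trans h1 _; apply: (eqX_cofactor (c := E) h).
rewrite thetaM; ring.
Qed.

Lemma theta_polY : theta Y =X 'X * E ^+ 2 * A ^+ 4.
Proof.
have h1 : theta Y =X 'X * E * (U + theta U) - 'X * U * E ^+ 2 * theta D.
  apply: (eqX_cofactor (c := 'X * U) thetaE).
  rewrite /Y !thetaM [theta 'X]/theta derivX; ring.
apply: eqX_trans h1 _.
apply: (eqX_cofactor (c := - 'X * E * (U + theta U)) DE).
rewrite -theta_polY_num; ring.
Qed.

Let YwY : (('X * w) \Po Y) =X Y * E ^+ 2 * A ^+ 5.
Proof.
rewrite /polw !comp_poly_simp -polw_homog.
apply: (eqX_cofactor (c := - Y * (1 + D * E - 11%:R * Y)) DE).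
rewrite /Y; ring.
Qed.

(** Since theta Y = X A^4 E^2 and w(Y) = A^5 E^2, the factor A U E turns theta (F(Y)) into (X w
    F')(Y). A second theta then yields theta Y times the equation of F taken at Y. *)
Lemma ode_left :
  theta (A * U * E * theta (F \Po Y)) =X
  'X * (A ^+ 4 * (3%:R * D + 'X * U) * E ^+ 3) * (F \Po Y).
Proof.
have h1 : A * U * E * theta (F \Po Y) =X ('X * w * F^`()) \Po Y.
  rewrite theta_comp comp_polyM.
  apply: (@eqX_trans _ _ (A * U * E * ('X * E ^+ 2 * A ^+ 4 * (F^`() \Po Y)))).
    by apply: eqXMl; apply: eqXMr; apply: theta_polY.
  apply: eqX_trans (eqXMr _ (eqX_sym YwY)).
  by rewrite [_ * _](_ : _ = Y * E ^+ 2 * A ^+ 5 * (F^`() \Po Y)) // /Y; ring.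
apply: eqX_trans (eqX_theta h1) _.
rewrite theta_comp.
apply: eqX_trans (eqXM theta_polY (eqX_comp Y0 odeF)) _.
rewrite !comp_poly_simp.
apply: (eqX_cofactor (c := - (3%:R * 'X * E ^+ 2 * A ^+ 4 * (F \Po Y))) DE).
rewrite /Y; ring.
Qed.

Let pE := polAUD K.

Let theta_p_F5 : A * U * D * theta (F \Po 'X^5) = 5%:R * (('X * w * F^`()) \Po 'X^5).
Proof.
rewrite pE theta_comp theta_Xn 2!comp_polyM comp_polyX; ring.
Qed.

Let ode_F5 : theta (A * U * D * theta (F \Po 'X^5)) =X
   25%:R * (3%:R * 'X^5 + 'X^10) * (F \Po 'X^5).
Proof.
rewrite theta_p_F5 thetaM theta_comp theta_Xn.
rewrite (_ : theta 5%:R = 0) ?mul0r ?add0r; last by rewrite -polyC_natr /theta derivC mulr0.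
rewrite [_ * _](_ : _ = 25%:R * 'X^5 * (('X * w * F^`())^`() \Po 'X^5)); last by ring.
have X50 : ('X^5 : {poly K})`_0 = 0 by rewrite coefXn.
apply: eqX_trans (eqXMl _ (eqX_comp X50 odeF)) _.
by rewrite [_ * _](_ : _ = 25%:R * (3%:R * 'X^5 + 'X^10) * (F \Po 'X^5)) //
  !comp_poly_simp; ring.
Qed.

(** The factor D produces the cross terms E V theta f and - E^2 theta D p theta f, which cancel
    because p = A U D and V = A U theta D. The rest is a multiple of f by [ode_F5], and
    [ode_transfer] identifies it. *)
Lemma ode_right :
  theta (A * U * E * theta (D * (F \Po 'X^5))) =X
  'X * (A ^+ 4 * (3%:R * D + 'X * U) * E ^+ 3) * (D * (F \Po 'X^5)).
Proof.
set f := F \Po 'X^5; set V := A * U * theta D; set p := A * U * D.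
have h1 : theta (A * U * E * theta (D * f)) =X theta (E * V * f + E * (p * theta f)).
  rewrite [A * U * E * _](_ : _ = E * V * f + E * (p * theta f)) //.
  by rewrite thetaM /V /p; ring.
have h2 : theta (E * V * f + E * (p * theta f)) =X
   (E * theta V - E ^+ 2 * theta D * V) * f + E * V * theta f
   - E ^+ 2 * theta D * (p * theta f) + E * theta (p * theta f).
  apply: (eqX_cofactor (c := V * f + p * theta f) thetaE).
  by rewrite !thetaD !(thetaM E) !(thetaM (E * V)) !(thetaM E); ring.
have h3 : (E * theta V - E ^+ 2 * theta D * V) * f + E * V * theta f
   - E ^+ 2 * theta D * (p * theta f) + E * theta (p * theta f) =X
   (E * theta V - E ^+ 2 * theta D * V) * f + E * theta (p * theta f).
  by apply: (eqX_cofactor (c := - (E * V * theta f)) DE); rewrite /V /p; ring.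
have h4 : (E * theta V - E ^+ 2 * theta D * V) * f + E * theta (p * theta f) =X
   (E * theta V - E ^+ 2 * theta D * V) * f + E * (25%:R * (3%:R * 'X^5 + 'X^10) * f).
  by apply: eqXD => //; apply: eqXMl; apply: ode_F5.
apply: eqX_trans h1 _; apply: eqX_trans h2 _; apply: eqX_trans h3 _.
apply: eqX_trans h4 _.
apply: (@eqX_trans _ _ (E ^+ 2 * (A ^+ 4 * 'X * (3%:R * D + 'X * U)) * f)).
  rewrite -ode_transfer -/V.
  apply: (eqX_cofactor (c := - (E * (theta V + 25%:R * (3%:R * 'X^5 + 'X^10)) * f)) DE).
  rewrite /V; ring.
apply: (eqX_cofactor (c := - (E ^+ 2 * (A ^+ 4 * 'X * (3%:R * D + 'X * U)) * f)) DE).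
ring.
Qed.

(** By [ode_left] and [ode_right] both sides solve the same linear equation, and both have constant
    term F(0); [eqX_ode_unique] makes their difference vanish. *)
Lemma modular_equation : (F \Po Y) =X D * (F \Po 'X^5).
Proof.
have comp0 (f : {poly K}) : f`_0 = 0 -> (F \Po f)`_0 = F`_0.
  by move=> f0; rewrite -horner_coef0 horner_comp (horner_coef0 f) f0 horner_coef0.
pose W := (F \Po Y) - D * (F \Po 'X^5).
suff: W =X 0.
  by move=> h i i_n; apply/eqP; rewrite -subr_eq0 -coefB h // coef0.
apply: (@eqX_ode_unique _ _ (A * U * E) (A ^+ 4 * (3%:R * D + 'X * U) * E ^+ 3)).
- rewrite !coef0M inverse_coef0 mulr1.
  by rewrite /polA /polU -!horner_coef0 !hornerE /=; ring.
- rewrite /W coefB (comp0 _ Y0) coef0M D0 comp0 ?coefXn //.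
  by rewrite mul1r subrr.
rewrite /W mulrBr !thetaB.
rewrite (_ : A * U * E * (theta (F \Po Y) - theta (D * (F \Po 'X^5))) =
  A * U * E * theta (F \Po Y) - A * U * E * theta (D * (F \Po 'X^5))); last by ring.
rewrite thetaB -[- theta _]mulN1r -[- ('X * _ * _)]mulN1r.
by apply: eqXD ode_left _; apply: eqXMl; apply: ode_right.
Qed.

End ModularEquation.

(** * Truncated logarithm series *)

Section LogSeries.
Variable K : numFieldType.
Implicit Types (z : {poly K}) (n : nat).

(** Truncates the series of -log(1 - z). *)
Definition nlog_1sub n z : {poly K} := \sum_(i < n) i.+1%:R^-1 *: z ^+ i.+1.

(** Under theta the sum becomes geometric, and the error z^n theta z vanishes modulo X^n. *)
Lemma theta_nlog_1sub n z : z`_0 = 0 -> eqX n ((1 - z) * theta (nlog_1sub n z)) (theta z).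
Proof.
move=> z0.
have -> : (1 - z) * theta (nlog_1sub n z) = theta z - z ^+ n * theta z.
  have -> : theta (nlog_1sub n z) = theta z * \sum_(i < n) z ^+ i.
    rewrite /theta /nlog_1sub raddf_sum /= -mulrA; congr ('X * _).
    rewrite mulr_sumr; apply: eq_bigr => i _.
    by rewrite derivZ deriv_exp -[(_ * _) *+ _]scaler_nat scalerA mulVf ?scale1r ?pnatr_eq0.
  rewrite [_ * _](_ : _ = - (theta z * ((z - 1) * \sum_(i < n) z ^+ i))); last by ring.
  by rewrite -subrX1; ring.
rewrite -[X in eqX _ _ X]subr0 -[X in eqX _ _ (_ - X)](mul0r (theta z)).
rewrite -![- (_ * theta z)]mulN1r; apply: eqXD => //; apply: eqXMl; apply: eqXMr.
exact: eqX_exp0.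
Qed.

End LogSeries.

(** * Coefficients of P at exponents divisible by five *)

Section FifthSection.
Variables (K : numFieldType) (n : nat) (E F G LU LD : {poly K}).
Local Notation A := (polA K).
Local Notation U := (polU K).
Local Notation D := (polD K).
Local Notation w := (polw K).
Local Notation "p =X q" := (eqX n p q) (at level 70).
Hypothesis DE : D * E =X 1.
Hypothesis odeF : ('X * w * F^`())^`() =X (3%:R + 'X) * F.
Hypothesis thetaG : theta G =X F - 1.
(** [LU] and [LD] stand for log U and log D and enter only through their logarithmic derivatives. *)
Hypothesis thetaLU : U * theta LU =X theta U.
Hypothesis thetaLD : D * theta LD =X theta D.
Let Y := 'X * U * E.
Let P := (G \Po Y) + LU - LD - 5%:R^-1 *: (G \Po 'X^5).

Let Q := A ^+ 5 * D - (w \Po 'X^5).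

Let Q_section m : Q`_(5 * m) = 0.
Proof.
(* The expansion has degree 14, and its terms of exponent 0, 5 and 10 cancel. *)
have -> : Q = - (2%:R * 'X^1) - 6%:R * 'X^2 + 7%:R * 'X^3 + 26%:R * 'X^4
   - 53%:R * 'X^6 - 9%:R * 'X^7 + 48%:R * 'X^8 + 39%:R * 'X^9
   - 23%:R * 'X^11 - 19%:R * 'X^12 - 7%:R * 'X^13 - 'X^14.
  by rewrite /Q /polw !comp_poly_simp /polA /polD; ring.
rewrite !mulr_natl !coefE.
have h k : (0 < k %% 5)%N -> (5 * m == k)%N = false.
  by move=> hk; apply/negP => /eqP e; move: hk; rewrite -e modnMr.
by rewrite !h // !mul0rn !(oppr0, addr0).
Qed.

Let comp5_coef (f : {poly K}) i : ~~ (5 %| i)%N -> (f \Po 'X^5)`_i = 0.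
Proof. by move=> h; rewrite coef_comp_poly_Xn // (negbTE h). Qed.

(** In U D theta P the terms free of F are U D + D theta U - U theta D - A^4, which is 0 by
    [theta_polY_num]. Multiplying by A and replacing F(Y) by D F(X^5) leaves F(X^5) (A^5 D - p). *)
Let thetaP : (w \Po 'X^5) * theta P =X (F \Po 'X^5) * Q.
Proof.
case: (posnP n) => [n0|n_gt0]; first by move=> i; rewrite n0.
have X50 : ('X^5 : {poly K})`_0 = 0 by rewrite coefXn.
have Y0 : Y`_0 = 0 by rewrite /Y -mulrA coefXM.
have hY : U * D * theta (G \Po Y) =X A ^+ 4 * ((F \Po Y) - 1).
  rewrite theta_comp.
  apply: (@eqX_trans _ _ (U * D * ('X * E ^+ 2 * A ^+ 4 * (G^`() \Po Y)))).
    by apply: eqXMl; apply: eqXMr; apply: theta_polY.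
  apply: (@eqX_trans _ _ (A ^+ 4 * (theta G \Po Y))).
    rewrite /theta comp_polyM comp_polyX.
    apply: (eqX_cofactor (c := A ^+ 4 * Y * (G^`() \Po Y)) DE).
    rewrite /Y; ring.
  apply: eqXMl; apply: eqX_trans (eqX_comp Y0 thetaG) _.
  by rewrite comp_polyB comp_polyC polyC1; apply: eqX_refl.
have hX : theta (5%:R^-1 *: (G \Po 'X^5)) =X (F \Po 'X^5) - 1.
  have -> : theta (5%:R^-1 *: (G \Po 'X^5)) = theta G \Po 'X^5.
    rewrite {1}/theta derivZ -scalerAr -/(theta _) theta_comp theta_Xn /theta comp_polyM comp_polyX.
    rewrite -mulrA -[5%:R in X in _ *: X]polyC_natr.
    by rewrite mul_polyC scalerA mulVf ?scale1r ?pnatr_eq0.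
  by apply: eqX_trans (eqX_comp X50 thetaG) _; rewrite comp_polyB comp_polyC polyC1; apply: eqX_refl.
have hP : U * D * theta P =X A ^+ 4 * (F \Po Y) - U * D * (F \Po 'X^5).
  rewrite /P !thetaB !thetaD.
  rewrite [U * D * _](_ : _ = U * D * theta (G \Po Y) + D * (U * theta LU)
    + - U * (D * theta LD) + - (U * D) * theta (5%:R^-1 *: (G \Po 'X^5))); last by ring.
  apply: eqX_trans (eqXD (eqXD (eqXD hY (eqXMl _ thetaLU)) (eqXMl _ thetaLD)) (eqXMl _ hX)) _.
  rewrite -{1}theta_polY_num.
  rewrite [X in eqX _ X _](_ : _ = A ^+ 4 * (F \Po Y) - U * D * (F \Po 'X^5)) //.
  rewrite -theta_polY_num; ring.
rewrite -polAUD [A * U * D * _](_ : _ = A * (U * D * theta P)); last by ring.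
apply: (@eqX_trans _ _ (A * (A ^+ 4 * (D * (F \Po 'X^5)) - U * D * (F \Po 'X^5)))).
  apply: eqXMl; apply: eqX_trans hP _; apply: eqXD => //; apply: eqXMl.
  exact: modular_equation.
by rewrite [X in eqX _ X _](_ : _ = (F \Po 'X^5) * Q) // /Q -polAUD; ring.
Qed.

(** Induction on the exponent in [thetaP]. As w(X^5) and F(X^5) live in exponents divisible by 5,
    the left side at such an index reduces to i P_i plus earlier coefficients that vanish, while the
    right side only meets zero coefficients of Q. The constant term is a hypothesis since theta
    kills it. *)
Lemma fifth_section_eq0 i : P`_0 = 0 -> (i < n)%N -> (5 %| i)%N -> P`_i = 0.
Proof.
move=> P0; elim/ltn_ind: i => -[|i] IH i_n d5 //.
have := thetaP i_n; rewrite coefMr big_ord_recr /= subnn.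
rewrite big1 ?add0r => [|[j /= j_i] _]; last first.
  have [dj|ndj] := boolP (5 %| j)%N.
    by rewrite coef_theta (IH j) ?mul0rn ?mulr0 //; lia.
  by rewrite comp5_coef ?mul0r // dvdn_subr // ltnW.
have -> : (w \Po 'X^5)`_0 = 1.
  by rewrite /polw !comp_poly_simp -horner_coef0 !hornerE /=; ring.
rewrite mul1r coef_theta coefM big1 => [|[j /= j_i] _]; last first.
  have [dj|ndj] := boolP (5 %| j)%N; last by rewrite comp5_coef ?mul0r.
  have /dvdnP[m ->] : (5 %| i.+1 - j)%N by apply: dvdn_sub.
  by rewrite mulnC Q_section mulr0.
by move/eqP; rewrite mulrn_eq0 /= => /eqP.
Qed.

End FifthSection.

(** * Apéry numbers *)

Definition apery (n : nat) : nat := \sum_(k < n.+1) 'C(n, k) ^ 2 * 'C(n + k, k).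

Section Apery.
Variable K : numFieldType.

(** In the field the difference n - k is not truncated; for k > n both binomials are 0. *)
Lemma natr_mul_bin_left n k :
  k.+1%:R * 'C(n, k.+1)%:R = (n%:R - k%:R) * 'C(n, k)%:R :> K.
Proof.
have [k_n|n_k] := leqP k n; first by rewrite -natrB // -!natrM mul_bin_left.
by rewrite !bin_small ?mulr0 //; lia.
Qed.

Let b n k : K := ('C(n, k) ^ 2 * 'C(n + k, k))%:R.
(** Certificate of creative telescoping: the summand [rec_term] of Apéry's recurrence is the
    difference of [cert m.+1] at consecutive k. *)
Let cert n k : K :=
  (k%:R ^+ 2 + 3%:R * (2%:R * n%:R + 1) * k%:R - 11%:R * n%:R ^+ 2 - 9%:R * n%:R - 2%:R)
  * b n k.
Let rec_term m k : K :=
  m.+2%:R ^+ 2 * b m.+2 k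
  - (11%:R * m.+1%:R ^+ 2 + 11%:R * m.+1%:R + 3%:R) * b m.+1 k - m.+1%:R ^+ 2 * b m k.

Let rec_term0 m : rec_term m 0 = cert m.+1 0.
Proof.
rewrite /rec_term /cert /b !bin0 -[m.+2]addn2 -[m.+1]addn1 !natrD; ring.
Qed.

Let rec_termS m j : rec_term m j.+1 = cert m.+1 j.+1 - cert m.+1 j.
Proof.
pose M : K := m%:R; pose J : K := j%:R.
have M1 : m.+1%:R = M + 1 by rewrite -natr1.
have M2 : m.+2%:R = M + 2%:R by rewrite -addn2 natrD.
have J1 : j.+1%:R = J + 1 by rewrite -natr1.
have M1n0 : M + 1 != 0 by rewrite -M1 pnatr_eq0.
have M2n0 : M + 2%:R != 0 by rewrite -M2 pnatr_eq0.
have J1n0 : J + 1 != 0 by rewrite -J1 pnatr_eq0.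
(* Every binomial involved is a rational multiple of [y] or [z], which turns the claim into an
   identity of rational functions in [M] and [J]. *)
pose y : K := 'C(m.+1, j)%:R; pose z : K := 'C(m.+1 + j, j)%:R.
have e1 : 'C(m.+1, j.+1)%:R = (M + 1 - J) / (J + 1) * y.
  apply: (mulfI J1n0); rewrite -[in LHS]J1 natr_mul_bin_left M1 -/y -/J; field.
  exact: J1n0.
have e2 : 'C(m.+2, j.+1)%:R = (M + 2%:R) / (J + 1) * y.
  by rewrite binS natrD e1 -/y; field.
have e0 : 'C(m, j)%:R = (M + 1 - J) / (M + 1) * y.
  apply: (mulfI M1n0); rewrite -M1 -natrM mul_bin_diag natrM e1 J1 M1; field.
  by rewrite M1n0 J1n0.
have e3 : 'C(m, j.+1)%:R = (M - J) * (M + 1 - J) / ((J + 1) * (M + 1)) * y.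
  apply: (mulfI J1n0); rewrite -[in LHS]J1 natr_mul_bin_left e0 -/M -/J; field.
  by rewrite M1n0 J1n0.
have f0 : 'C(m + j.+1, j.+1)%:R = (M + 1) / (J + 1) * z.
  apply: (mulfI J1n0); rewrite -[in LHS]J1 natr_mul_bin_left addnS -addSn -/z.
  by rewrite natrD M1 -/J; field.
have f1 : 'C(m.+1 + j.+1, j.+1)%:R = (M + 2%:R + J) / (J + 1) * z.
  have f0' : 'C(m.+1 + j, j.+1)%:R = (M + 1) / (J + 1) * z by rewrite -f0 addSnnS.
  by rewrite addnS binS natrD f0' -/z; field.
have f2 : 'C(m.+2 + j.+1, j.+1)%:R = (M + 3%:R + J) * (M + 2%:R + J) / ((J + 1) * (M + 2%:R)) * z.
  have h : m.+2%:R * 'C(m.+2 + j.+1, j.+1)%:R =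
           (m.+2 + j.+1)%:R * 'C(m.+1 + j.+1, j.+1)%:R :> K.
    rewrite -!natrM; have := mul_bin_down (m.+2 + j.+1) j.+1.
    by rewrite addnK addSn /= => ->.
  apply: (mulfI M2n0); rewrite -[in LHS]M2 h f1 natrD M2 J1; field.
  by rewrite M2n0 J1n0.
rewrite /rec_term /cert /b !natrM ?natrX e1 e2 e3 f0 f1 f2 -/y -/z M1 M2 J1 -/J; field.
by rewrite M1n0 M2n0 J1n0.
Qed.

Let sum_rec_term m N : \sum_(k < N.+1) rec_term m k = cert m.+1 N.
Proof.
elim: N => [|N IH]; first by rewrite big_ord1 rec_term0.
by rewrite big_ord_recr /= IH rec_termS; ring.
Qed.

Let aperyE n N : (n <= N)%N -> (apery n)%:R = \sum_(k < N.+1) b n k.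
Proof.
move=> n_N; rewrite /apery natr_sum.
rewrite (big_ord_widen_cond _ predT (fun k => b n k) (n_N : (n.+1 <= N.+1)%N)) big_mkcond /=.
apply: eq_bigr => k _; case: ifP => // /negbT; rewrite -leqNgt => k_n.
by rewrite /b bin_small.
Qed.

(** The three sums are extended to k <= m + 2, where the telescoped value [cert m.+1 m.+2] is 0
    because its binomial C(m+1, m+2) is. *)
Lemma apery_rec m :
  m.+2%:R ^+ 2 * (apery m.+2)%:R =
  (11%:R * m.+1%:R ^+ 2 + 11%:R * m.+1%:R + 3%:R) * (apery m.+1)%:R
  + m.+1%:R ^+ 2 * (apery m)%:R :> K.
Proof.
have := sum_rec_term m m.+2; rewrite /cert /b bin_small // mul0n mulr0.
rewrite /rec_term !sumrB -!mulr_sumr -!aperyE //; last by lia.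
by move=> /eqP; rewrite subr_eq0 subr_eq => /eqP ->; rewrite addrC.
Qed.

End Apery.

Lemma apery0 : apery 0 = 1%N. Proof. by rewrite /apery big_ord1. Qed.
Lemma apery1 : apery 1 = 3%N. Proof. by rewrite /apery big_ord_recl big_ord1. Qed.

(** Induction on two consecutive values: with N = n + 1, the recurrence needs only 12 (11 N^2 + 11 N
    + 3) + N^2 <= 144 (N + 1)^2. *)
Lemma apery_le n : (apery n <= 12 ^ n)%N.
Proof.
suff: (apery n <= 12 ^ n)%N /\ (apery n.+1 <= 12 ^ n.+1)%N by case.
elim: n => [|n [IH0 IH1]]; first by rewrite apery0 apery1.
split=> //; have := apery_rec rat n.
rewrite -!(natrX, natrM, natrD) => /eqP; rewrite eqr_nat => /eqP e.
rewrite -(@leq_pmul2l (n.+2 ^ 2)) ?expn_gt0 // e.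
apply: leq_trans (leq_add (leq_mul (leqnn _) IH1) (leq_mul (leqnn _) IH0)) _.
rewrite !expnS; move: (12 ^ n)%N => t; nia.
Qed.

(** * Apéry's differential equation for the generating series *)

Section GeneratingSeries.
Variable K : numFieldType.

(** The degree goes up to [n] because coefficient i < n of the differential equation involves
    a_(i+1). *)
Definition apery_poly n : {poly K} := \poly_(i < n.+1) (apery i)%:R.
Definition apery_log_poly n : {poly K} :=
  \sum_(i < n) ((apery i.+1)%:R / i.+1%:R) *: 'X^(i.+1).

Lemma apery_ode n :
  eqX n (('X * polw K * (apery_poly n)^`())^`()) ((3%:R + 'X) * apery_poly n).
Proof.
move=> i i_n.
set F := apery_poly n.
rewrite coef_deriv -mulrA coefXM /=.
rewrite (_ : polw K * F^`() = F^`() - 11%:R * ('X * F^`()) - 'X^2 * F^`()); last first.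
  by rewrite /polw; ring.
rewrite (_ : (3%:R + 'X) * F = 3%:R * F + 'X * F); last by ring.
rewrite !(coefB, coefD) !mulr_natl !coefMn !coefXM coefXnM /F.
rewrite !coef_deriv !coef_poly.
(* Indices 0 and 1 are treated apart, as some of the shifted coefficients are absent there. *)
case: i i_n => [|[|i]] i_n.
- by rewrite /= ltnS i_n apery0 apery1; ring.
- rewrite /= !ltnS i_n (ltnW i_n) apery0 apery1.
  have := apery_rec K 0; rewrite apery0 apery1 => h.
  rewrite [LHS](_ : _ = 2%:R ^+ 2 * (apery 2)%:R - 66%:R); last by ring.
  by rewrite h; ring.
rewrite subn2 /= !ltnS i_n !(ltnW i_n) (ltnW (ltnW i_n)).
rewrite [LHS](_ : _ = i.+3%:R ^+ 2 * (apery i.+3)%:R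
  - i.+3%:R * (11%:R * i.+2%:R * (apery i.+2)%:R + i.+1%:R * (apery i.+1)%:R)); last by ring.
by rewrite (apery_rec K i.+1); ring.
Qed.

Lemma theta_apery_log n : eqX n (theta (apery_log_poly n)) (apery_poly n - 1).
Proof.
move=> i i_n; rewrite coef_theta coefB coef_poly coef1 ltnS (ltnW i_n).
rewrite /apery_log_poly coef_sum.
case: i i_n => [|i] i_n; first by rewrite mulr0n apery0 subrr.
rewrite subr0 (bigD1 (Ordinal (ltnW i_n))) //= big1 => [|j]; last first.
  by rewrite -val_eqE /= coefZ coefXn eqSS eq_sym => /negbTE ->; rewrite mulr0.
by rewrite coefZ coefXn eqxx mulr1 addr0 -[LHS]mulr_natr mulfVK ?pnatr_eq0.
Qed.

End GeneratingSeries.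

(** * Weighted norms *)

Section WeightedNorm.
Variables (K : realFieldType) (rho : K).
Hypothesis rho_ge0 : 0 <= rho.
Implicit Types p q : {poly K}.

(** Weighted l^1 norm. It is submultiplicative, so a composite such as [polP] can be bounded without
    computing its coefficients. *)
Definition wnorm p : K := \sum_(i < size p) `|p`_i| * rho ^+ i.

Lemma wnorm_wide m p : (size p <= m)%N -> wnorm p = \sum_(i < m) `|p`_i| * rho ^+ i.
Proof.
move=> p_m; rewrite /wnorm (big_ord_widen_cond m predT (fun i => `|p`_i| * rho ^+ i)) //.
rewrite big_mkcond /=; apply: eq_bigr => i _; case: ltnP => // p_i.
by rewrite nth_default // normr0 mul0r.
Qed.

Lemma wnorm_le_horner p q : (forall i, `|p`_i| <= q`_i) -> wnorm p <= q.[rho].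
Proof.
move=> pq; rewrite (wnorm_wide (leq_maxl (size p) (size q))).
rewrite (horner_coef_wide _ (leq_maxr (size p) (size q))).
by apply: ler_sum => i _; apply: ler_wpM2r; rewrite ?exprn_ge0.
Qed.

(** The norm is the value at [rho] of the polynomial of absolute values, so norm inequalities reduce
    to coefficientwise ones. *)
Let abs_poly p := \poly_(i < size p) `|p`_i|.

Let coef_abs p i : (abs_poly p)`_i = `|p`_i|.
Proof. by rewrite coef_poly; case: ltnP => // h; rewrite nth_default ?normr0. Qed.

Let horner_abs p : (abs_poly p).[rho] = wnorm p.
Proof. by rewrite horner_poly. Qed.

Lemma wnorm_ge0 p : 0 <= wnorm p.
Proof. by apply: sumr_ge0 => i _; rewrite mulr_ge0 ?exprn_ge0. Qed.

Lemma wnormD p q : wnorm (p + q) <= wnorm p + wnorm q.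
Proof.
rewrite -!horner_abs -hornerD horner_abs; apply: wnorm_le_horner => i.
by rewrite !coefD !coef_abs ler_normD.
Qed.

Lemma wnormN p : wnorm (- p) = wnorm p.
Proof. by rewrite /wnorm size_polyN; apply: eq_bigr => i _; rewrite coefN normrN. Qed.

Lemma wnormB p q : wnorm (p - q) <= wnorm p + wnorm q.
Proof. by rewrite -(wnormN q); apply: wnormD. Qed.

Lemma wnormM p q : wnorm (p * q) <= wnorm p * wnorm q.
Proof.
rewrite -!horner_abs -hornerM horner_abs; apply: wnorm_le_horner => i.
rewrite !coefM (le_trans (ler_norm_sum _ _ _)) //; apply: ler_sum => j _.
by rewrite normrM !coef_abs.
Qed.

Lemma wnormZ c p : wnorm (c *: p) <= `|c| * wnorm p.
Proof.
rewrite -!horner_abs -hornerZ horner_abs; apply: wnorm_le_horner => i.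
by rewrite !coefZ coef_abs normrM.
Qed.

Lemma wnormXn m : wnorm 'X^m <= rho ^+ m.
Proof.
by rewrite -[rho ^+ m]hornerXn; apply: wnorm_le_horner => i; rewrite coefXn normr_nat.
Qed.

Lemma wnorm1 : wnorm 1 <= 1.
Proof.
rewrite -[1 in leRHS](hornerC _ rho); apply: wnorm_le_horner => i.
by rewrite coefC; case: ifP; rewrite ?normr1 ?normr0.
Qed.

Lemma wnorm_exp m p : wnorm (p ^+ m) <= wnorm p ^+ m.
Proof.
elim: m => [|m IH]; first exact: wnorm1.
by rewrite !exprS (le_trans (wnormM _ _)) // ler_wpM2l ?wnorm_ge0.
Qed.

Lemma wnorm_sum m (f : nat -> {poly K}) :
  wnorm (\sum_(i < m) f i) <= \sum_(i < m) wnorm (f i).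
Proof.
elim: m => [|m IH]; first by rewrite !big_ord0 /wnorm size_poly0 big_ord0.
by rewrite !big_ord_recr /= (le_trans (wnormD _ _)) // lerD2r.
Qed.

(** The exponent [e] is the successor for the logarithmic series and the identity for the geometric
    one; [x] absorbs the growth of the coefficients. *)
Lemma wnorm_power_sum m (c : nat -> K) (e : nat -> nat) x p :
  (forall i, `|c i| * wnorm p ^+ e i <= x ^+ e i) ->
  wnorm (\sum_(i < m) c i *: p ^+ e i) <= \sum_(i < m) x ^+ e i.
Proof.
move=> h; apply: le_trans (wnorm_sum _ (fun i => c i *: p ^+ e i)) _.
apply: ler_sum => i _; apply: le_trans (h i); apply: le_trans (wnormZ _ _) _.
by rewrite ler_wpM2l ?wnorm_exp.
Qed.

End WeightedNorm.

Lemma sum_exp_le2 (K : realFieldType) m (x : K) :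
  0 <= x -> x <= 2%:R^-1 -> \sum_(i < m) x ^+ i <= 2%:R.
Proof.
move=> x0 x2; have x1 : 0 < 1 - x by lra.
have := subrX1 x m; move: (\sum_(i < m) x ^+ i) (exprn_ge0 m x0) => s t0 e.
have {}e : (1 - x) * s <= 1 by rewrite -[1 - x]opprB mulNr -e; lra.
have : (1 - x) * s <= (1 - x) * 2%:R by apply: le_trans e _; lra.
by rewrite ler_pM2l.
Qed.

Lemma sum_expS_le1 (K : realFieldType) m (x : K) :
  0 <= x -> x <= 2%:R^-1 -> \sum_(i < m) x ^+ i.+1 <= 1.
Proof.
move=> x0 x2; under eq_bigr do rewrite exprS.
rewrite -mulr_sumr; have := sum_exp_le2 m x0 x2; have : 0 <= \sum_(i < m) x ^+ i.
  by apply: sumr_ge0 => i _; apply: exprn_ge0.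
nra.
Qed.

(** * The truncated series P and a bound uniform in [n] *)

Section Remainder.
Variable K : realFieldType.
Local Notation U := (polU K).
Local Notation D := (polD K).

(* [polE n] inverts [polD] modulo X^n, so that [polY n] truncates [Yfun]; [polP n]
   truncates the series P of the header. *)
Definition polE n : {poly K} := \sum_(i < n) (1 - D) ^+ i.
Definition polY n : {poly K} := 'X * U * polE n.
Definition polP n : {poly K} :=
  (apery_log_poly K n \Po polY n) - nlog_1sub n (1 - U) + nlog_1sub n (1 - D)
  - 5%:R^-1 *: (apery_log_poly K n \Po 'X^5).

Let D0 : (1 - D)`_0 = 0.
Proof. by rewrite /polD -horner_coef0 !hornerE /=; ring. Qed.

Let U0 : (1 - U)`_0 = 0.
Proof. by rewrite /polU -horner_coef0 !hornerE /=; ring. Qed.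

Lemma polDE n : D * polE n = 1 - (1 - D) ^+ n.
Proof. by have := subrX1 (1 - D) n; rewrite -/(polE n) => h; rewrite -[RHS]opprB h; ring. Qed.

Lemma polP_coef0 n : (polP n)`_0 = 0.
Proof.
have comp0 (f : {poly K}) : f`_0 = 0 -> (apery_log_poly K n \Po f)`_0 = 0.
  move=> f0; rewrite -horner_coef0 horner_comp (horner_coef0 f) f0.
  rewrite /apery_log_poly horner_sum big1 // => i _.
  by rewrite hornerZ hornerXn exprS mul0r mulr0.
have log0 (z : {poly K}) : z`_0 = 0 -> (nlog_1sub n z)`_0 = 0.
  move=> z0; rewrite /nlog_1sub coef_sum big1 // => i _.
  by rewrite coefZ exprS coef0M z0 mul0r mulr0.
rewrite /polP !(coefB, coefD, coefZ) !log0 // !comp0 ?coefXn //; first by ring.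
by rewrite /polY -mulrA coefXM.
Qed.

Lemma polP_section n i : (i < n)%N -> (5 %| i)%N -> (polP n)`_i = 0.
Proof.
pose LU : {poly K} := - nlog_1sub n (1 - U); pose LD : {poly K} := - nlog_1sub n (1 - D).
have PE : polP n = (apery_log_poly K n \Po ('X * U * polE n)) + LU - LD
     - 5%:R^-1 *: (apery_log_poly K n \Po 'X^5) by rewrite /polP /LU /LD opprK.
rewrite PE => i_n d5.
have thetaN (p : {poly K}) : theta (- p) = - theta p by rewrite /theta derivN mulrN.
have theta1 : theta (1 : {poly K}) = 0 by rewrite /theta derivC mulr0.
have hL (Z : {poly K}) : (1 - Z)`_0 = 0 -> eqX n (Z * theta (- nlog_1sub n (1 - Z))) (theta Z).
  move=> Z0; have := theta_nlog_1sub (n := n) Z0.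
  rewrite [1 - (1 - Z)](_ : _ = Z); last by ring.
  rewrite thetaB theta1 sub0r thetaN mulrN => h j j_n.
  by rewrite coefN h // coefN opprK.
apply: (@fifth_section_eq0 _ n (polE n) (apery_poly K n)) => //; rewrite -?PE ?polP_coef0 //.
- by move=> j j_n; rewrite polDE coefB (@eqX_exp0 _ n) // coef0 subr0.
- exact: apery_ode.
- exact: theta_apery_log.
- exact: hL.
exact: hL.
Qed.

(** At radius 1/100 both 1 - U and 1 - D have norm at most 1/2, so each logarithm has norm at most
    1. Since a_n <= 12^n, the same holds for G at any argument of norm at most 1/24; Y qualifies
    with 1/100 * 3/2 * 2, and so does X^5. *)
Lemma wnorm_polP n : wnorm 100%:R^-1 (polP n) <= 4%:R.
Proof.
set rho : K := 100%:R^-1.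
have rho_ge0 : 0 <= rho by rewrite /rho; lra.
pose N := wnorm rho.
have N_natXn m k : N (m%:R * 'X^k) <= m%:R * rho ^+ k.
  rewrite -polyC_natr mul_polyC; apply: le_trans (wnormZ rho_ge0 _ _) _.
  by rewrite normr_nat ler_wpM2l // wnormXn.
have N1 : N 1 <= 1 := wnorm1 rho_ge0.
have r2 : rho ^+ 2 = 10000%:R^-1 by rewrite /rho; field.
have r3 : rho ^+ 3 = 1000000%:R^-1 by rewrite /rho; field.
have r4 : rho ^+ 4 = 100000000%:R^-1 by rewrite /rho; field.
have ND : N (1 - D) <= 2%:R^-1.
  rewrite (_ : 1 - D = - (3%:R * 'X^1 + 4%:R * 'X^2 + 2%:R * 'X^3 + 1%:R * 'X^4)).
    rewrite /N wnormN.
    have := wnormD rho_ge0 (3%:R * 'X^1) (4%:R * 'X^2).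
    have := wnormD rho_ge0 (3%:R * 'X^1 + 4%:R * 'X^2) (2%:R * 'X^3).
    have := wnormD rho_ge0 (3%:R * 'X^1 + 4%:R * 'X^2 + 2%:R * 'X^3) (1%:R * 'X^4).
    have := N_natXn 3 1; have := N_natXn 4 2; have := N_natXn 2 3; have := N_natXn 1%N 4.
    rewrite /N r2 r3 r4 expr1 /rho; lra.
  by rewrite /polD; ring.
have NU : N (1 - U) <= 2%:R^-1.
  rewrite (_ : 1 - U = 2%:R * 'X^1 - 4%:R * 'X^2 + 3%:R * 'X^3 - 1%:R * 'X^4).
    have := wnormB rho_ge0 (2%:R * 'X^1) (4%:R * 'X^2).
    have := wnormD rho_ge0 (2%:R * 'X^1 - 4%:R * 'X^2) (3%:R * 'X^3).
    have := wnormB rho_ge0 (2%:R * 'X^1 - 4%:R * 'X^2 + 3%:R * 'X^3) (1%:R * 'X^4).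
    have := N_natXn 2 1; have := N_natXn 4 2; have := N_natXn 3 3; have := N_natXn 1%N 4.
    rewrite /N r2 r3 r4 expr1 /rho; lra.
  by rewrite /polU; ring.
have N0 (p : {poly K}) : 0 <= N p by apply: wnorm_ge0.
have Nlog (z : {poly K}) : N z <= 2%:R^-1 -> N (nlog_1sub n z) <= 1.
  move=> hz; apply: le_trans (sum_expS_le1 n (N0 z) hz).
  apply: (@wnorm_power_sum _ _ rho_ge0 n (fun i => i.+1%:R^-1) succn) => i.
  rewrite -/N normfV normr_nat ler_piMl ?exprn_ge0 //.
  by rewrite invf_le1 ?ltr0n // ler1n.
have NG (f : {poly K}) : N f <= 24%:R^-1 -> N (apery_log_poly K n \Po f) <= 1.
  move=> hf; have x2 : 12%:R * N f <= 2%:R^-1 by lra.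
  have x0 : 0 <= 12%:R * N f by rewrite mulr_ge0.
  apply: le_trans (sum_expS_le1 n x0 x2).
  rewrite /apery_log_poly raddf_sum /=.
  under eq_bigr do rewrite comp_polyZ comp_Xn_poly.
  apply: (@wnorm_power_sum _ _ rho_ge0 n (fun i => (apery i.+1)%:R / i.+1%:R) succn) => i.
  rewrite -/N exprMn ler_wpM2r ?exprn_ge0 // normrM normfV !normr_nat.
  apply: (@le_trans _ _ (apery i.+1)%:R).
    by rewrite ler_piMr ?invf_le1 ?ltr0n ?ler1n.
  by rewrite -natrX ler_nat apery_le.
have NE : N (polE n) <= 2%:R.
  apply: le_trans (sum_exp_le2 n (N0 (1 - D)) ND).
  rewrite /polE; under eq_bigr do rewrite -[_ ^+ _]scale1r.
  by apply: (@wnorm_power_sum _ _ rho_ge0 n (fun=> 1) id) => i; rewrite normr1 mul1r.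
have NY : N (polY n) <= 24%:R^-1.
  have hU : N U <= 3%:R / 2%:R.
    have := wnormB rho_ge0 1 (1 - U); rewrite [1 - (1 - U)](_ : _ = U); last by ring.
    by rewrite -/N; lra.
  have hX := wnormXn rho_ge0 1; rewrite !expr1 -/N in hX.
  apply: le_trans (wnormM rho_ge0 _ _) _; rewrite -/N.
  have hXU : N ('X * U) <= rho * (3%:R / 2%:R).
    by apply: le_trans (wnormM rho_ge0 _ _) _; apply: ler_pM.
  apply: le_trans (ler_pM (N0 _) (N0 _) hXU NE) _; rewrite /rho; lra.
have NX5 : N 'X^5 <= 24%:R^-1.
  apply: le_trans (wnormXn rho_ge0 5) _; rewrite exprS r4 /rho; lra.
have := wnormB rho_ge0 (apery_log_poly K n \Po polY n) (nlog_1sub n (1 - U)).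
have := wnormD rho_ge0 (apery_log_poly K n \Po polY n - nlog_1sub n (1 - U)) (nlog_1sub n (1 - D)).
have := wnormB rho_ge0 (apery_log_poly K n \Po polY n - nlog_1sub n (1 - U) + nlog_1sub n (1 - D))
  (5%:R^-1 *: (apery_log_poly K n \Po 'X^5)).
have := wnormZ rho_ge0 5%:R^-1 (apery_log_poly K n \Po 'X^5).
rewrite -/(polP n) -/N normfV normr_nat.
have := Nlog _ NU; have := Nlog _ ND; have := NG _ NY; have := NG _ NX5; lra.
Qed.

End Remainder.

(** * Complex logarithm estimate *)

Local Open Scope classical_set_scope.
Local Open Scope ring_scope.
Local Open Scope complex_scope.
Local Notation Re := (@complex.Re _).
Local Notation Im := (@complex.Im _).

Section ComplexNorm.
Variable R : rcfType.
Local Notation nc := (@Normc.normc R).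
Implicit Types (x y z : R[i]) (c : R).

Lemma normc_ge0 z : 0 <= nc z.
Proof. by case: z => a b /=; apply: sqrtr_ge0. Qed.

Lemma normc_gt0 z : z != 0 -> 0 < nc z.
Proof.
move=> z0; rewrite lt_neqAle normc_ge0 andbT eq_sym; apply: contra z0 => /eqP h.
by apply/eqP; apply: Normc.eq0_normc.
Qed.

Lemma normcX z n : nc (z ^+ n) = nc z ^+ n.
Proof. by elim: n => [|n IH]; rewrite ?Normc.normc1 // !exprS Normc.normcM IH. Qed.

Lemma normcB x y : nc (x - y) <= nc x + nc y.
Proof. by rewrite -[nc y]normcN; apply: le_normcD. Qed.

Lemma normc_sum (I : finType) (f : I -> R[i]) : nc (\sum_i f i) <= \sum_i nc (f i).
Proof.
elim/big_ind2: _ => [|x c y d xc yd|//]; first by rewrite Normc.normc0.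
by rewrite (le_trans (le_normcD _ _)) // lerD.
Qed.

Lemma normc_real c : nc c%:C = `|c|.
Proof. by rewrite /= expr0n /= addr0 sqrtr_sqr. Qed.

Lemma normc_nat n : nc n%:R = n%:R.
Proof. by rewrite -(rmorph_nat (real_complex R)) normc_real normr_nat. Qed.

Lemma normr_Re_le z : `|Re z| <= nc z.
Proof.
by case: z => a b /=; rewrite -sqrtr_sqr ler_wsqrtr // lerDl sqr_ge0.
Qed.

Lemma ReD x y : Re (x + y) = Re x + Re y. Proof. by case: x; case: y. Qed.
Lemma ReN x : Re (- x) = - Re x. Proof. by case: x. Qed.
Lemma ReB x y : Re (x - y) = Re x - Re y. Proof. by rewrite ReD ReN. Qed.
Lemma ImD x y : Im (x + y) = Im x + Im y. Proof. by case: x; case: y. Qed.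
Lemma ReM x y : Re (x * y) = Re x * Re y - Im x * Im y. Proof. by case: x; case: y. Qed.
Lemma ImM x y : Im (x * y) = Re x * Im y + Im x * Re y. Proof. by case: x; case: y. Qed.

Lemma Re_sum (I : finType) (f : I -> R[i]) : Re (\sum_i f i) = \sum_i Re (f i).
Proof. exact: (big_morph _ ReD). Qed.

Lemma ReZ c z : Re (c%:C * z) = c * Re z.
Proof. by rewrite ReM /= mul0r subr0. Qed.

Lemma Re_divn z n : Re (z / n%:R) = Re z / n%:R.
Proof.
by rewrite -(rmorph_nat (real_complex R)) -fmorphV mulrC ReZ mulrC.
Qed.

Lemma normc_sqr z : nc z ^+ 2 = Re z ^+ 2 + Im z ^+ 2.
Proof. by case: z => a b /=; rewrite sqr_sqrtr // addr_ge0 ?sqr_ge0. Qed.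

Lemma Re_inv z : Re z^-1 = Re z / nc z ^+ 2.
Proof. by rewrite normc_sqr; case: z. Qed.

Lemma Im_inv z : Im z^-1 = - Im z / nc z ^+ 2.
Proof. by rewrite normc_sqr; case: z => a b; rewrite /= mulNr. Qed.

Lemma normc_inv_le2 z : nc (1 - z) <= 2%:R^-1 -> 2%:R^-1 <= nc z.
Proof.
have := le_normcD (1 - z) z; rewrite subrK Normc.normc1; lra.
Qed.

Definition evalc (p : {poly R}) z : R[i] := (map_poly (real_complex R) p).[z].

Lemma evalcE p z : evalc p z = \sum_(i < size p) (p`_i)%:C * z ^+ i.
Proof.
by rewrite /evalc horner_coef size_map_poly; apply: eq_bigr => i _; rewrite coef_map.
Qed.

Lemma evalcD p q z : evalc (p + q) z = evalc p z + evalc q z.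
Proof. by rewrite /evalc rmorphD hornerD. Qed.

Lemma evalcB p q z : evalc (p - q) z = evalc p z - evalc q z.
Proof. by rewrite /evalc rmorphB hornerD hornerN. Qed.

Lemma evalcM p q z : evalc (p * q) z = evalc p z * evalc q z.
Proof. by rewrite /evalc rmorphM hornerM. Qed.

Lemma evalcZ c p z : evalc (c *: p) z = c%:C * evalc p z.
Proof. by rewrite /evalc map_polyZ hornerZ. Qed.

Lemma evalc_nat n z : evalc n%:R z = n%:R.
Proof. by rewrite /evalc rmorph_nat -polyC_natr hornerC. Qed.

Lemma evalc1 z : evalc 1 z = 1.
Proof. exact: (evalc_nat 1). Qed.

Lemma evalcXn n z : evalc 'X^n z = z ^+ n.
Proof. by rewrite /evalc map_polyXn hornerXn. Qed.

Lemma evalcX z : evalc 'X z = z.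
Proof. by rewrite -['X]expr1 evalcXn expr1. Qed.

Lemma evalc_exp n p z : evalc (p ^+ n) z = evalc p z ^+ n.
Proof. by elim: n => [|n IH]; rewrite ?evalc1 // !exprS evalcM IH. Qed.

Lemma evalc_sum (I : finType) (f : I -> {poly R}) z :
  evalc (\sum_i f i) z = \sum_i evalc (f i) z.
Proof. by rewrite /evalc rmorph_sum horner_sum. Qed.

Lemma evalc_comp p q z : evalc (p \Po q) z = evalc p (evalc q z).
Proof. by rewrite /evalc map_comp_poly horner_comp. Qed.

Lemma evalc_nlog_1sub n p z :
  evalc (nlog_1sub n p) z = \sum_(i < n) evalc p z ^+ i.+1 / i.+1%:R.
Proof.
rewrite /nlog_1sub evalc_sum; apply: eq_bigr => i _.
by rewrite evalcZ evalc_exp fmorphV rmorph_nat mulrC.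
Qed.

End ComplexNorm.

Section LogEstimate.
Variable R : realType.
Local Notation nc := (@Normc.normc R).

(** Mean value theorem on the segment from 0 to z, with real functions only: the derivative of log|1
    - s z| plus the real part of the truncated series is Re(- z (s z)^n / (1 - s z)), and |1 - s z|
    >= 1/2. *)
Lemma ln_normc_1sub n (z : R[i]) : nc z <= 2%:R^-1 ->
  `|ln (nc (1 - z)) + Re (\sum_(i < n) z ^+ i.+1 / i.+1%:R)| <= 2%:R * nc z ^+ n.+1.
Proof.
move=> z2; set a := Re z; set b := Im z.
(* For real s, Re((s z)^k) = s^k Re(z^k), so the truncated series along the segment is a real
   polynomial in s. *)
pose q : {poly R} := \sum_(i < n) (Re (z ^+ i.+1) / i.+1%:R) *: 'X^(i.+1).
pose h (s : R) := (1 - s * a) ^+ 2 + (s * b) ^+ 2.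
have hE s : h s = nc (1 - s%:C * z) ^+ 2.
  by rewrite normc_sqr /h /a /b; case: (z) => x y; rewrite /=; ring.
have s1 (s : R) : s \in `[0, 1] -> nc (s%:C * z) <= nc z.
  rewrite in_itv /= => /andP[s0 s1]; rewrite Normc.normcM normc_real ger0_norm //.
  by rewrite ler_piMl ?normc_ge0.
have pos (s : R) : s \in `[0, 1] -> 2%:R^-1 <= nc (1 - s%:C * z).
  move=> hs; apply: normc_inv_le2; rewrite opprB addrC subrK.
  exact: le_trans (s1 _ hs) z2.
have hpos (s : R) : s \in `[0, 1] -> 0 < h s.
  by move=> /pos hs; rewrite hE exprn_gt0 // (lt_le_trans _ hs) // invr_gt0.
pose f (s : R) := 2%:R^-1 * ln (h s) + q.[s].
pose df (s : R) := 2%:R^-1 * ((h s)^-1 * (2%:R * (1 - s * a) * (- a) + 2%:R * (s * b) * b)) + q^`().[s].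
have dh (s : R) : is_derive s 1 h (2%:R * (1 - s * a) * (- a) + 2%:R * (s * b) * b).
  rewrite /h; apply: is_derive_eq.
  rewrite /GRing.scale /=; ring.
have dff (s : R) : s \in `[0, 1] -> is_derive s 1 f (df s).
  move=> hs; have hp := hpos s hs; have dl := is_derive1_ln hp.
  have dlh : is_derive s 1 (fun s => ln (h s)) ((h s)^-1 * (2%:R * (1 - s * a) * (- a) + 2%:R * (s * b) * b)).
    exact: is_derive1_comp.
  by rewrite /f /df; apply: is_derive_eq.
have cf : {within `[0, 1], continuous f}.
  apply: derivable_within_continuous => s hs.
  by have [] := dff s hs.
have [c hc] := MVT_segment ler01 (fun s hs => dff s (subset_itv_oo_cc hs)) cf.
have -> : f 1 = ln (nc (1 - z)) + Re (\sum_(i < n) z ^+ i.+1 / i.+1%:R).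
  have p1 : 0 < nc (1 - 1%:C * z).
    by apply: lt_le_trans (pos 1 _); rewrite ?invr_gt0 // in_itv /= ler01 lexx.
  rewrite /f hE lnXn // rmorph1 mul1r -[ln _ *+ 2]mulr_natl mulKf ?pnatr_eq0 // Re_sum; congr (_ + _).
  rewrite horner_sum; apply: eq_bigr => i _.
  by rewrite hornerZ hornerXn expr1n mulr1 Re_divn.
have -> : f 0 = 0.
  rewrite /f /h !mul0r subr0 expr1n expr0n addr0 ln1 mulr0 add0r horner_sum big1 // => i _.
  by rewrite hornerZ hornerXn expr0n mulr0.
rewrite !subr0 mulr1 => ->.
set w := 1 - c%:C * z; have w2 := pos c hc; rewrite -/w in w2.
have w0 : w != 0.
  by apply/eqP => w0; move: w2; rewrite w0 Normc.normc0 leNgt invr_gt0 ltr0n.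
have dfE : df c = Re (- (z * (c%:C * z) ^+ n / w)).
  (* The geometric sum separates the derivative of the logarithm from that of [q]. *)
  have -> : - (z * (c%:C * z) ^+ n / w) = - (z / w) + z * \sum_(i < n) (c%:C * z) ^+ i.
    have := subrX1 (c%:C * z) n; move: (\sum_(i < n) _) => S.
    rewrite (_ : c%:C * z - 1 = - w); last by rewrite /w opprB.
    by move/eqP; rewrite subr_eq => /eqP ->; field.
  rewrite ReD /df; congr (_ + _).
    rewrite ReN ReM Re_inv Im_inv hE -/w /a /b.
    have -> : Re w = 1 - c * Re z by rewrite /w ReB ReZ.
    have -> : Im w = - (c * Im z) by rewrite /w; case: (z) => x y /=; ring.
    field; apply/eqP => h0; move: w2; rewrite h0; lra.
  rewrite mulr_sumr Re_sum raddf_sum /= horner_sum; apply: eq_bigr => i _.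
  rewrite derivZ derivXn /= hornerZ hornerMn hornerXn exprMn mulrCA -exprS.
  rewrite -rmorphXn ReZ -mulr_natr; field.
  by rewrite ?nat1r ?natr1 pnatr_eq0.
rewrite dfE; apply: le_trans (normr_Re_le _) _.
have -> : 2%:R * nc z ^+ n.+1 = nc z * nc z ^+ n * 2%:R by rewrite exprS; ring.
rewrite normcN !Normc.normcM Normc.normcV normcX Normc.normcM.
apply: ler_pM.
- by rewrite mulr_ge0 ?exprn_ge0 ?mulr_ge0 ?normc_ge0.
- by rewrite invr_ge0 normc_ge0.
- rewrite ler_wpM2l ?normc_ge0 // lerXn2r ?nnegrE ?mulr_ge0 ?normc_ge0 //.
  by rewrite -Normc.normcM s1.
by rewrite -[2%:R]invrK lef_pV2 ?posrE ?invr_gt0 // (lt_le_trans _ w2) ?invr_gt0.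
Qed.

End LogEstimate.

(** * Integrals over the unit circle *)

Section UnitCircle.
Variable R : realType.
Local Notation nc := (@Normc.normc R).
Local Notation e := (@expi2pi R).

Lemma expi2piD a b : e (a + b) = e a * e b.
Proof.
by rewrite /expi2pi mulrDr cosD sinD; apply/eqP; rewrite eq_complex /= eqxx addrC eqxx.
Qed.

Lemma expi2pi0 : e 0 = 1.
Proof. by rewrite /expi2pi mulr0 cos0 sin0. Qed.

Lemma expi2pi1 : e 1 = 1.
Proof. by rewrite /expi2pi mulr1 mulr_natl cos2pi sin2pi. Qed.

Lemma expi2pi_nat n a : e a ^+ n = e (n%:R * a).
Proof.
elim: n => [|n IH]; first by rewrite mul0r expi2pi0.
by rewrite exprS IH -expi2piD -natr1 mulrDl mul1r addrC.
Qed.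

Lemma normc_expi2pi a : nc (e a) = 1.
Proof. by rewrite /= cos2Dsin2 sqrtr1. Qed.

Lemma expi2pi_neq0 a : e a != 0.
Proof.
apply/eqP => h; have := normc_expi2pi a.
by rewrite h Normc.normc0 => /eqP; rewrite eq_sym oner_eq0.
Qed.

Lemma expi2piV a : (e a)^-1 = e (- a).
Proof.
apply: (mulfI (expi2pi_neq0 a)); rewrite mulfV ?expi2pi_neq0 //.
by rewrite -expi2piD subrr expi2pi0.
Qed.

Definition ccont (f : R -> R[i]) :=
  continuous (fun x => Re (f x)) /\ continuous (fun x => Im (f x)).

Lemma ccont_cst c : ccont (fun=> c).
Proof. by split=> x; apply: cvg_cst. Qed.

Lemma ccontD f g : ccont f -> ccont g -> ccont (fun x => f x + g x).
Proof.
move=> [f1 f2] [g1 g2]; split=> x.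
  under [X in continuous_at _ X]eq_fun do rewrite ReD.
  by apply: cvgD; [exact: f1|exact: g1].
under [X in continuous_at _ X]eq_fun do rewrite ImD.
by apply: cvgD; [exact: f2|exact: g2].
Qed.

Lemma ccontM f g : ccont f -> ccont g -> ccont (fun x => f x * g x).
Proof.
move=> [f1 f2] [g1 g2]; split=> x.
  under [X in continuous_at _ X]eq_fun do rewrite ReM.
  by apply: cvgB; apply: cvgM; [exact: f1|exact: g1|exact: f2|exact: g2].
under [X in continuous_at _ X]eq_fun do rewrite ImM.
by apply: cvgD; apply: cvgM; [exact: f1|exact: g2|exact: f2|exact: g1].
Qed.

Lemma ccontX f n : ccont f -> ccont (fun x => f x ^+ n).
Proof.
move=> cf; elim: n => [|n IH]; first exact: ccont_cst.
by under eq_fun do rewrite exprS; apply: ccontM.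
Qed.

Lemma ccont_horner f (p : {poly R[i]}) : ccont f -> ccont (fun x => p.[f x]).
Proof.
move=> cf; elim/poly_ind: p => [|p c IH].
  by under eq_fun do rewrite horner0; apply: ccont_cst.
under eq_fun do rewrite hornerMXaddC; apply: ccontD; last exact: ccont_cst.
exact: ccontM.
Qed.

Lemma ccont_expi2pi (s : R) : ccont (fun x => e (s * x)).
Proof.
have c0 : continuous (fun x : R => 2 * pi * (s * x)).
  move=> x; apply: cvgM; first exact: cvg_cst.
  by apply: cvgM; [exact: cvg_cst|exact: cvg_id].
by split=> x; apply: (continuous_comp (c0 x)); [exact: continuous_cos|exact: continuous_sin].
Qed.

Lemma ccont_expi : ccont e.
Proof. by have := ccont_expi2pi 1; under eq_fun do rewrite mul1r. Qed.

Lemma ccont_expiV : ccont (fun x => (e x)^-1).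
Proof. by have := ccont_expi2pi (-1); under eq_fun do rewrite mulN1r -expi2piV. Qed.

Lemma continuous_ln_normc f : ccont f -> (forall x, f x != 0) ->
  continuous (fun x => ln (nc (f x))).
Proof.
move=> [f1 f2] f0 x.
have e0 : (fun x => nc (f x)) = (fun x => Num.sqrt (Re (f x) * Re (f x) + Im (f x) * Im (f x))).
  by apply/funext => y; rewrite -!expr2; case: (f y).
have c1 : {for x, continuous (fun x => nc (f x))}.
  rewrite e0; apply: (@continuous_comp _ _ _ _ Num.sqrt); last exact: sqrt_continuous.
  by apply: cvgD; apply: cvgM; [exact: f1|exact: f1|exact: f2|exact: f2].
by apply: (continuous_comp c1); apply: continuous_ln; apply: normc_gt0.
Qed.

End UnitCircle.

Section UnitIntervalIntegral.
Variable R : realType.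
Local Notation mu := (@lebesgue_measure R).
Local Notation I01 := (`[0%R, 1%R]%classic : set R).
Local Notation int01 f := (Rintegral mu I01 f).
Implicit Types f g : R -> R.

Lemma continuous_integrable01 f : continuous f -> mu.-integrable I01 (EFin \o f).
Proof.
move=> cf; apply: continuous_compact_integrable; first exact: segment_compact.
exact: continuous_subspaceT.
Qed.

Lemma measurable01 : measurable (I01 : set (measurableTypeR R)).
Proof. exact: measurable_itv. Qed.

Lemma lebesgue01 : mu I01 = 1%:E.
Proof. by rewrite lebesgue_measure_itv /= lte_fin ltr01 sube0. Qed.

Lemma int01_cst c : int01 (fun=> c) = c.
Proof.
rewrite (Rintegral_cst mu measurable01).
by rewrite [X in fine X]lebesgue01 mulr1.
Qed.

Lemma int01D f g : continuous f -> continuous g ->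
  int01 (fun x => f x + g x) = int01 f + int01 g.
Proof.
by move=> cf cg; apply: RintegralD; [exact: measurable01|exact: continuous_integrable01..].
Qed.

Lemma int01_sum (I : finType) (f : I -> R -> R) : (forall i, continuous (f i)) ->
  int01 (fun x => \sum_i f i x) = \sum_i int01 (f i).
Proof.
(* Continuity of the partial sums joins the induction, as additivity of the integral requires it. *)
move=> cf; suff [] : continuous (fun x => \sum_i f i x) /\
  int01 (fun x => \sum_i f i x) = \sum_i int01 (f i) by [].
elim: (index_enum I) => [|i s [IH1 IH2]].
  split; first by move=> x; under [X in continuous_at _ X]eq_fun do rewrite big_nil; exact: cvg_cst.
  by rewrite big_nil -[RHS](int01_cst 0); apply: eq_Rintegral => x _; rewrite big_nil.
have e : (fun x => \sum_(j <- i :: s) f j x) = (fun x => f i x + \sum_(j <- s) f j x).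
  by apply/funext => x; rewrite big_cons.
split; first by rewrite e => x; apply: cvgD; [exact: cf|exact: IH1].
by rewrite big_cons -IH2 e int01D.
Qed.

Lemma int01_dist_le f g c :
  mu.-integrable I01 (EFin \o f) -> mu.-integrable I01 (EFin \o g) ->
  (forall x, `|f x - g x| <= c) -> `|int01 f - int01 g| <= c.
Proof.
move=> hf hg h; rewrite -(RintegralB measurable01 hf hg).
have hfg : mu.-integrable I01 (EFin \o (fun x => f x - g x)).
  by have := integrableB measurable01 hf hg.
apply: le_trans (le_normr_Rintegral measurable01 hfg) _.
rewrite -[leRHS]int01_cst; apply: le_Rintegral => //.
- exact: (integrable_norm hfg).
by apply: continuous_integrable01 => x; exact: cvg_cst.
Qed.

(** The integrand has an explicit antiderivative of period 1. *)
Lemma int01_expi2pi k (w : R[i]) : (0 < k)%N ->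
  int01 (fun x => Re (w * expi2pi x ^+ k)) = 0.
Proof.
move=> k0; set K : R := 2 * pi * k%:R.
have Kn0 : K != 0 by rewrite !mulf_neq0 ?pnatr_eq0 -?lt0n // gt_eqF // pi_gt0.
have kE (x : R) : 2 * pi * (k%:R * x) = K * x by rewrite /K mulrA.
pose F (x : R) := K^-1 * (Re w * sin (K * x) + Im w * cos (K * x)).
have dF (x : R) : is_derive x 1 F (Re (w * expi2pi x ^+ k)).
  have dl : is_derive x 1 (fun x => K * x) K.
    by apply: is_derive_eq; rewrite /GRing.scale /= mulr1.
  have ds : is_derive x 1 (fun x => sin (K * x)) (cos (K * x) * K).
    exact: (is_derive1_comp (is_derive_sin (K * x)) dl).
  have dc : is_derive x 1 (fun x => cos (K * x)) (- sin (K * x) * K).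
    exact: (is_derive1_comp (is_derive_cos (K * x)) dl).
  rewrite /F; apply: is_derive_eq.
  rewrite expi2pi_nat ReM /= kE /GRing.scale /=; field; exact: Kn0.
have cF : continuous F.
  by move=> x; apply: differentiable_continuous; apply/derivable1_diffP; have [] := dF x.
have cf : continuous (fun x : R => Re (w * expi2pi x ^+ k)).
  by have [] := ccontM (ccont_cst w) (ccontX k (ccont_expi R)).
rewrite /Rintegral (@continuous_FTC2 _ _ F) ?ltr01 //.
- have F01 : F 1 = F 0.
    rewrite /F mulr1 mulr0 /K -[2 * pi * k%:R]mulr1 -[2 * pi * k%:R * 1]mulrA mulr1.
    have := expi2pi_nat k (1 : R); rewrite expi2pi1 expr1n mulr1.
    by rewrite /expi2pi => -[<- <-]; rewrite sin0 cos0.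
  by rewrite F01 /= subrr.
- exact: continuous_subspaceT.
- split; first by move=> x _; have [] := dF x.
  + exact: cvg_at_right_filter (cF 0).
  exact: cvg_at_left_filter (cF 1).
by move=> x _; rewrite derive1E; have [] := dF x.
Qed.

Lemma int01_expi2piV k (w : R[i]) : (0 < k)%N ->
  int01 (fun x => Re (w * (expi2pi x)^-1 ^+ k)) = 0.
Proof.
move=> k0; rewrite -[RHS](int01_expi2pi (conjc w) k0); apply: eq_Rintegral => x _.
rewrite expi2piV !expi2pi_nat mulrN /expi2pi mulrN cosN sinN.
by case: w => a b /=; ring.
Qed.

(** Orthogonality of characters: after multiplication by the power -m of the variable, only the term
    of index m survives integration. *)
Lemma int01_coef (p : {poly R[i]}) (c : R[i]) m :
  int01 (fun x => Re (c * (expi2pi x)^-1 ^+ m * p.[expi2pi x])) = Re (c * p`_m).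
Proof.
(* [N] exceeds [m] even when [p] has smaller degree, so that index [m] occurs in the sum. *)
pose N := maxn (size p) m.+1.
have m_N : (m < N)%N by rewrite leq_max leqnn orbT.
pose f (i : 'I_N) (x : R) := Re (c * p`_i * ((expi2pi x)^-1 ^+ m * expi2pi x ^+ i)).
have cf i : continuous (f i).
  have h := ccontM (ccontX m (ccont_expiV R)) (ccontX i (ccont_expi R)).
  by have [] := ccontM (ccont_cst (c * p`_i)) h.
transitivity (int01 (fun x => \sum_i f i x)).
  apply: eq_Rintegral => x _; rewrite (horner_coef_wide _ (leq_maxl _ _ : size p <= N)%N).
  rewrite mulr_sumr Re_sum; apply: eq_bigr => i _.
  by rewrite /f; congr (Re _); ring.
rewrite int01_sum // (bigD1 (Ordinal m_N)) //= big1 => [|i i_m].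
  rewrite addr0 -[RHS]int01_cst; apply: eq_Rintegral => x _.
  by rewrite /f -exprMn mulVf ?expi2pi_neq0 // expr1n mulr1.
have {}i_m : (i : nat) != m by rewrite -val_eqE in i_m.
have [lt|lt|e] := ltngtP i m; last by rewrite e eqxx in i_m.
- rewrite -[RHS](@int01_expi2piV (m - i) (c * p`_i)) ?subn_gt0 //.
  apply: eq_Rintegral => x _; rewrite /f -[in _ ^+ m](subnK (ltnW lt)) exprD.
  by rewrite -[X in _ * X]mulrA -exprMn mulVf ?expi2pi_neq0 // expr1n mulr1.
rewrite -[RHS](@int01_expi2pi (i - m) (c * p`_i)) ?subn_gt0 //.
apply: eq_Rintegral => x _; rewrite /f -[X in expi2pi x ^+ X](subnKC (ltnW lt)) exprD.
by rewrite [X in _ * X]mulrA -exprMn mulVf ?expi2pi_neq0 // expr1n mul1r.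
Qed.

End UnitIntervalIntegral.

(** * Apéry numbers as constant terms *)

Section ConstantTerm.
Variable T : comNzRingType.

Lemma coef_XaddC_exp (S : comNzRingType) (c : S) m i :
  (('X + c%:P) ^+ m)`_i = c ^+ (m - i) *+ 'C(m, i).
Proof.
rewrite addrC exprDn coef_sum.
have [i_m|m_i] := leqP i m; last first.
  rewrite bin_small // mulr0n big1 // => -[j /= j_m] _.
  by rewrite coefMn -rmorphXn coefCM coefXn; case: eqP => [|_]; [lia|rewrite mulr0 mul0rn].
rewrite (bigD1 (Ordinal (i_m : (i < m.+1)%N))) //= big1 => [|j].
  by rewrite addr0 coefMn -rmorphXn coefCM coefXn eqxx mulr1.
rewrite -val_eqE /= => j_i; rewrite coefMn -rmorphXn coefCM coefXn eq_sym (negbTE j_i).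
by rewrite mulr0 mul0rn.
Qed.

(* The outer variable is y and the inner one is x. *)
Definition kernel_poly : {poly {poly T}} :=
  ('X%:P + 'X + 1) * ('X%:P + 1) * ('X + 1).

(** With s = x + 1 the kernel is s (y + s) (y + 1). The coefficient of y^m in its m-th power is the
    sum of C(m,k)^2 s^(m+k), and x^m in s^(m+k) contributes C(m+k,k). *)
Lemma kernel_poly_coef m : (((kernel_poly ^+ m)`_m)`_m : T) = (apery m)%:R.
Proof.
pose s : {poly T} := 'X + 1%:P.
have -> : kernel_poly = s%:P * (('X + s%:P) * ('X + 1%:P)).
  by rewrite /kernel_poly /s polyCD !polyC1; ring.
rewrite exprMn -rmorphXn coefCM exprMn (coefMr (('X + s%:P) ^+ m)) mulr_sumr coef_sum /apery natr_sum.
apply: eq_bigr => -[k /= k_m] _.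
rewrite !coef_XaddC_exp expr1n subKn // bin_sub //.
rewrite -mulr_natr -[_ *+ _ in X in _ * X]mulr_natr.
rewrite [_ * _](_ : _ = s ^+ (m + k) * ('C(m, k) * 'C(m, k))%:R); last first.
  by rewrite natrM exprD; ring.
rewrite mulr_natr coefMn coef_XaddC_exp expr1n -mulrnA; congr (_ *+ _).
by have := bin_sub (leq_addl m k); rewrite addnK -mulnn mulnC => <-.
Qed.

End ConstantTerm.

Lemma half_pow_le (R : realType) (eps : R) : 0 < eps ->
  exists N, forall n, (N <= n)%N -> 2%:R^-1 ^+ n <= eps.
Proof.
move=> eps_gt0; have h : `|2%:R^-1 : R| < 1 by rewrite ger0_norm //; lra.
have /cvgrPdist_le /(_ _ eps_gt0) [N _ hN] := cvg_expr h.
exists N => n N_n; have := hN n N_n.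
by rewrite /= sub0r normrN ger0_norm // exprn_ge0.
Qed.

(** * Expansion of the Mahler measure for small [t] *)

Section MahlerExpansion.
Variable R : realType.
Local Notation nc := (@Normc.normc R).
Local Notation e := (@expi2pi R).
Local Notation mu := (@lebesgue_measure R).
Local Notation I01 := (`[0%R, 1%R]%classic : set R).
Local Notation int01 f := (Rintegral mu I01 f).

Lemma evalc_apery_log n (t : R[i]) :
  evalc (apery_log_poly R n) t = \sum_(i < n) t ^+ i.+1 / i.+1%:R * (apery i.+1)%:R.
Proof.
rewrite /apery_log_poly evalc_sum; apply: eq_bigr => i _.
by rewrite evalcZ evalcXn fmorph_div !rmorph_nat mulrC mulrA mulrAC.
Qed.

Lemma kernel_poly_horner (x y : R[i]) m :
  (map_poly (horner_eval x) (kernel_poly R[i] ^+ m)).[y] =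
  ((x + y + 1) * (x + 1) * (y + 1)) ^+ m.
Proof.
rewrite rmorphXn horner_exp /kernel_poly !rmorphM !rmorphD /= !rmorph1.
rewrite !map_polyX !map_polyC /= /horner_eval hornerX.
by rewrite !hornerE.
Qed.

Variable t : R[i].
Hypothesis t_neq0 : t != 0.
Hypothesis t_small : nc t <= 24%:R^-1.

Let k x y : R[i] := (e x + e y + 1) * (e x + 1) * (e y + 1) * (e x)^-1 * (e y)^-1.
Let P x y : R[i] :=
  (e x + e y + 1) * (e x + 1) * (e y + 1) - t^-1 * e x * e y.

(** The monomial pulled out has modulus 1/|t| on the torus. In what remains |t k| <= 1/2, since |k|
    <= 12 and |t| <= 1/24. *)
Let PE x y : P x y = - (t^-1 * e x * e y) * (1 - t * k x y).
Proof.
rewrite /P /k; field.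
by rewrite t_neq0 !expi2pi_neq0.
Qed.

Let tk_small x y : nc (t * k x y) <= 2%:R^-1.
Proof.
rewrite /k !(Normc.normcM, Normc.normcV) !normc_expi2pi !invr1 !mulr1.
have h1 : nc (e x + e y + 1) <= 3%:R.
  apply: le_trans (le_normcD _ _) _; have := le_normcD (e x) (e y).
  rewrite !normc_expi2pi Normc.normc1; lra.
have h2 z : nc (e z + 1) <= 2%:R.
  by apply: le_trans (le_normcD _ _) _; rewrite normc_expi2pi Normc.normc1.
have h3 : nc (e x + e y + 1) * nc (e x + 1) * nc (e y + 1) <= 3%:R * 2%:R * 2%:R.
  by do ! apply: ler_pM; rewrite ?mulr_ge0 ?normc_ge0.
apply: le_trans (ler_pM (normc_ge0 _) _ t_small h3) _.
  by rewrite !mulr_ge0 ?normc_ge0.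
lra.
Qed.

Let one_sub_tk_gt0 x y : 0 < nc (1 - t * k x y).
Proof.
have : 2%:R^-1 <= nc (1 - t * k x y).
  by apply: normc_inv_le2; rewrite opprB addrC subrK.
by apply: lt_le_trans; rewrite invr_gt0.
Qed.

Let P_neq0 x y : P x y != 0.
Proof.
rewrite PE mulf_neq0 ?oppr_eq0 ?mulf_neq0 ?invr_eq0 ?expi2pi_neq0 //.
by apply/eqP => h; have := one_sub_tk_gt0 x y; rewrite h Normc.normc0 ltxx.
Qed.

Let lnP x y : ln (nc (P x y)) = - ln (nc t) + ln (nc (1 - t * k x y)).
Proof.
rewrite PE Normc.normcM normcN !Normc.normcM Normc.normcV !normc_expi2pi !mulr1.
have t0 := normc_gt0 t_neq0.
by rewrite lnM ?posrE ?invr_gt0 // lnV.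
Qed.

(** [g n] truncates the logarithm in the integrand and [J n] is its integral over y; [q m], the
    coefficient of y^m in the m-th kernel power, is a polynomial in x. *)
Let q m := (kernel_poly R[i] ^+ m)`_m.
Let g n x y := - ln (nc t) + - Re (\sum_(i < n) (t * k x y) ^+ i.+1 / i.+1%:R).
Let J n x := - ln (nc t) +
  \sum_(i < n) Re (- (t ^+ i.+1 / i.+1%:R) * (e x)^-1 ^+ i.+1 * (q i.+1).[e x]).

Let ccont_k x : ccont (k x).
Proof.
have ce := ccont_expi R; have c1 := ccont_cst (1 : R[i]).
rewrite /k; apply: ccontM; last exact: ccont_expiV.
apply: ccontM; last exact: ccont_cst.
apply: ccontM; last exact: ccontD.
apply: ccontM; last exact: ccont_cst.
by apply: ccontD => //; apply: ccontD => //; apply: ccont_cst.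
Qed.

Let ccont_P x : ccont (P x).
Proof.
have ce := ccont_expi R; have c1 := ccont_cst (1 : R[i]).
have -> : P x = (fun y => - (t^-1 * e x) * e y * (1 + - t * k x y)).
  by apply/funext => y; rewrite PE; ring.
apply: ccontM; first by apply: ccontM => //; apply: ccont_cst.
by apply: ccontD => //; apply: ccontM; [exact: ccont_cst|exact: ccont_k].
Qed.

Let continuous_f x : continuous (fun y => ln (nc (P x y))).
Proof. exact: continuous_ln_normc (ccont_P x) (P_neq0 x). Qed.

Let gE n x y : g n x y = - ln (nc t) +
  \sum_(i < n) Re ((- (t ^+ i.+1 / i.+1%:R) * (e x)^-1 ^+ i.+1) * (e y)^-1 ^+ i.+1
    * (map_poly (horner_eval (e x)) (kernel_poly R[i] ^+ i.+1)).[e y]).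
Proof.
rewrite /g; congr (_ + _); rewrite Re_sum -sumrN; apply: eq_bigr => i _.
rewrite kernel_poly_horner -ReN; congr (Re _); rewrite /k !exprMn; ring.
Qed.

Let continuous_gi (i : nat) x : continuous (fun y =>
  Re ((- (t ^+ i.+1 / i.+1%:R) * (e x)^-1 ^+ i.+1) * (e y)^-1 ^+ i.+1
    * (map_poly (horner_eval (e x)) (kernel_poly R[i] ^+ i.+1)).[e y])).
Proof.
have [] // := ccontM (ccontM (ccont_cst (- (t ^+ i.+1 / i.+1%:R) * (e x)^-1 ^+ i.+1))
  (ccontX i.+1 (ccont_expiV R)))
  (ccont_horner (map_poly (horner_eval (e x)) (kernel_poly R[i] ^+ i.+1)) (ccont_expi R)).
Qed.

Let continuous_sum (I : finType) (f : I -> R -> R) :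
  (forall i, continuous (f i)) -> continuous (fun x => \sum_i f i x).
Proof.
move=> cf; elim: (index_enum I) => [|i s IH] x.
  by under [X in continuous_at _ X]eq_fun do rewrite big_nil; exact: cvg_cst.
under [X in continuous_at _ X]eq_fun do rewrite big_cons.
by apply: cvgD; [exact: cf|exact: IH].
Qed.

Let continuous_g n x : continuous (g n x).
Proof.
rewrite (funext (gE n x)).
move=> y; apply: cvgD; first exact: cvg_cst.
by apply: continuous_sum => i; apply: continuous_gi.
Qed.

Let int_g n x : int01 (g n x) = J n x.
Proof.
rewrite (funext (gE n x)).
rewrite int01D; first last.
- by apply: continuous_sum => i; apply: continuous_gi.
- by move=> y; exact: cvg_cst.
rewrite int01_cst int01_sum => [|i]; last exact: continuous_gi.
congr (_ + _); apply: eq_bigr => i _; rewrite int01_coef.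
by congr (Re (_ * _)); rewrite coef_map.
Qed.

Let continuous_Ji (i : nat) : continuous (fun x : R =>
  Re (- (t ^+ i.+1 / i.+1%:R) * (e x)^-1 ^+ i.+1 * (q i.+1).[e x])).
Proof.
by have [] // := ccontM (ccontM (ccont_cst (- (t ^+ i.+1 / i.+1%:R)))
  (ccontX i.+1 (ccont_expiV R))) (ccont_horner (q i.+1) (ccont_expi R)).
Qed.

Let continuous_J n : continuous (J n).
Proof.
move=> y; apply: cvgD; first exact: cvg_cst.
by apply: continuous_sum => i; apply: continuous_Ji.
Qed.

Let int_J n : int01 (J n) = - ln (nc t) - Re (evalc (apery_log_poly R n) t).
Proof.
rewrite int01D; first last.
- by apply: continuous_sum => i; apply: continuous_Ji.
- by move=> y; exact: cvg_cst.
rewrite int01_cst int01_sum => [|i]; last exact: continuous_Ji.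
congr (_ + _); rewrite evalc_apery_log Re_sum -sumrN; apply: eq_bigr => i _.
by rewrite int01_coef /q kernel_poly_coef -ReN mulNr.
Qed.

Let fg n x y : `|ln (nc (P x y)) - g n x y| <= 2%:R * 2%:R^-1 ^+ n.+1.
Proof.
rewrite lnP /g; set S := \sum_(_ < _) _.
have -> : - ln (nc t) + ln (nc (1 - t * k x y)) - (- ln (nc t) - Re S) =
  ln (nc (1 - t * k x y)) + Re S by ring.
apply: le_trans (ln_normc_1sub n (tk_small x y)) _.
by rewrite ler_wpM2l // lerXn2r ?nnegrE ?normc_ge0 ?invr_ge0.
Qed.

Let I x := int01 (fun y => ln (nc (P x y))).

Let IJ n x : `|I x - J n x| <= 2%:R * 2%:R^-1 ^+ n.+1.
Proof.
rewrite -int_g; apply: int01_dist_le => [||y]; last exact: fg.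
- exact: continuous_integrable01.
exact: continuous_integrable01.
Qed.

Let integrable_I : mu.-integrable I01 (EFin \o I).
Proof.
apply: measurable_bounded_integrable => //.
- by rewrite [X in (X < _)%E]lebesgue01 ltry.
(* The inner integral is the limit of the continuous functions [J n], hence measurable in x. *)
- apply: (measurable_realfun.measurable_fun_cvg (h := J)) => [n|x _].
    by apply: measurable_funTS; apply: measurable_realfun.continuous_measurable_fun; apply: continuous_J.
  apply/cvgrPdist_le => eps eps_gt0; have [N hN] := half_pow_le eps_gt0.
  exists N => // n /= N_n; apply: le_trans (IJ n x) _.
  by rewrite exprS mulrA mulfV ?mul1r ?hN ?pnatr_eq0.
(* The truncation without terms, [J 0] = - ln |t|, is within 1 of the inner integral. *)
exists (`|ln (nc t)| + 1); split=> [|M /ltW h_M x _ /=]; first exact: num_real.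
apply: le_trans h_M.
have := IJ 0 x; rewrite expr1 mulfV ?pnatr_eq0 // /J big_ord0 addr0 opprK => h.
rewrite -[I x](addrK (ln (nc t))); apply: le_trans (ler_normB _ _) _.
by rewrite addrC lerD2l.
Qed.

(** The pointwise error is uniform on the torus and passes unchanged through both integrals over
    intervals of length 1. *)
Lemma r_expansion n :
  `|r t - (- ln (nc t) - Re (evalc (apery_log_poly R n) t))| <= 2%:R * 2%:R^-1 ^+ n.+1.
Proof.
rewrite -int_J; apply: int01_dist_le; last exact: IJ.
- exact: integrable_I.
exact: continuous_integrable01.
Qed.

End MahlerExpansion.

(** * Summation over the fifth roots *)

Section FifthRoots.
Variable R : realType.
Local Notation nc := (@Normc.normc R).
Local Notation zeta := (zeta5 R).

Lemma zeta5_exp5 : zeta ^+ 5 = 1.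
Proof. by rewrite /zeta5 expi2pi_nat mul1r mulfV ?pnatr_eq0 // expi2pi1. Qed.

Lemma normc_zeta5X j : nc (zeta ^+ j) = 1.
Proof. by rewrite normcX normc_expi2pi expr1n. Qed.

Lemma zeta5_neq1 : zeta != 1.
Proof.
apply/eqP => /(congr1 Im) /= h.
have : 0 < sin (2 * pi * (1 / 5%:R) : R).
  apply: sin_gt0_pi; have := pi_gt0 R; move=> ?; apply/andP; split; lra.
by rewrite h ltxx.
Qed.

(** For each remainder 1 to 4 modulo 5, zeta^i = 1 together with zeta^5 = 1 would force zeta = 1. *)
Lemma zeta5X_neq1 i : ~~ (5 %| i)%N -> zeta ^+ i != 1.
Proof.
move=> ndi; apply/eqP => h.
have {h} : zeta ^+ (i %% 5) = 1.
  by move: h; rewrite {1}(divn_eq i 5) exprD mulnC exprM zeta5_exp5 expr1n mul1r.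
have := zeta5_neq1; have := zeta5_exp5; move: ndi; rewrite /dvdn.
case: (i %% 5)%N (ltn_pmod i (isT : 0 < 5)%N) => [|[|[|[|[|]]]]] // _ _ z5 /eqP z1 h; apply: z1.
- exact: h.
- rewrite -[RHS]z5 [RHS](_ : _ = zeta ^+ 2 * zeta ^+ 2 * zeta); last by ring.
  by rewrite h !mul1r.
- rewrite -[RHS]mulr1 -[X in _ = 1 * X]h -[X in _ = X * _]h.
  by rewrite -[LHS]mul1r -[X in X * _]z5; ring.
rewrite -[LHS]mulr1 -[X in _ * X]h -[RHS]z5; ring.
Qed.

Lemma sum_zeta5 i : ~~ (5 %| i)%N -> \sum_(j < 5) (zeta ^+ j) ^+ i = 0.
Proof.
move=> ndi; have z1 : zeta ^+ i - 1 != 0 by rewrite subr_eq0 zeta5X_neq1.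
apply: (mulfI z1); under eq_bigr do rewrite exprAC.
by rewrite -subrX1 exprAC zeta5_exp5 expr1n subrr mulr0.
Qed.

(** The sum over the roots kills exponents not divisible by 5, and the hypothesis kills the others
    below [n]. For i >= n, |z|^i <= 2^-n rho^i. *)
Lemma fifth_section_bound (p : {poly R}) n rho z :
  (forall i, (i < n)%N -> (5 %| i)%N -> p`_i = 0) -> 0 <= rho -> nc z <= rho / 2%:R ->
  nc (\sum_(j < 5) evalc p (zeta ^+ j * z)) <= 5%:R * 2%:R^-1 ^+ n * wnorm rho p.
Proof.
move=> p0 rho0 hz.
have -> : \sum_(j < 5) evalc p (zeta ^+ j * z) =
    \sum_(i < size p) (p`_i)%:C * z ^+ i * \sum_(j < 5) (zeta ^+ j) ^+ i.
  under eq_bigr do rewrite evalcE.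
  rewrite exchange_big /=; apply: eq_bigr => i _; rewrite mulr_sumr.
  by apply: eq_bigr => j _; rewrite exprMn; ring.
apply: le_trans (normc_sum _) _; rewrite /wnorm mulr_sumr; apply: ler_sum => i _.
have rhs0 : 0 <= 5%:R * 2%:R^-1 ^+ n * (`|p`_i| * rho ^+ i).
  by rewrite !mulr_ge0 ?exprn_ge0 ?invr_ge0.
have [d5|nd5] := boolP (5 %| i)%N; last by rewrite sum_zeta5 // mulr0 Normc.normc0.
have [lt_in|le_ni] := ltnP i n; first by rewrite p0 // !mul0r Normc.normc0 normr0 mul0r mulr0.
rewrite !Normc.normcM normc_real normcX.
have h5 : nc (\sum_(j < 5) (zeta ^+ j) ^+ i) <= 5%:R.
  apply: le_trans (normc_sum _) _.
  by under eq_bigr do rewrite normcX normc_zeta5X expr1n; rewrite sumr_const card_ord.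
have hzi : nc z ^+ i <= 2%:R^-1 ^+ n * rho ^+ i.
  apply: (@le_trans _ _ ((rho / 2%:R) ^+ i)).
    by rewrite lerXn2r ?nnegrE ?normc_ge0 ?divr_ge0.
  rewrite exprMn mulrC ler_wpM2r ?exprn_ge0 // ler_wiXn2l ?invr_ge0 //; lra.
rewrite (_ : 5%:R * _ * _ = `|p`_i| * (2%:R^-1 ^+ n * rho ^+ i) * 5%:R); last by ring.
by rewrite !ler_pM ?mulr_ge0 ?exprn_ge0 ?normc_ge0.
Qed.

End FifthRoots.

(** * Error estimates at one point and the final summation *)

Section Assembly.
Variables (R : realType) (n : nat).
Local Notation nc := (@Normc.normc R).
Local Notation G := (apery_log_poly R n).
Local Notation h := ((2%:R^-1 : R) ^+ n).

Let h_ge0 : 0 <= h. Proof. by rewrite exprn_ge0 ?invr_ge0. Qed.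
Let hS : 2%:R * 2%:R^-1 ^+ n.+1 = h.
Proof. by rewrite exprS mulrA mulfV ?mul1r ?pnatr_eq0. Qed.

Lemma normc_subX_le (x y : R[i]) M i : nc x <= M -> nc y <= M ->
  nc (x ^+ i.+1 - y ^+ i.+1) <= i.+1%:R * nc (x - y) * M ^+ i.
Proof.
move=> xM yM; have M0 : 0 <= M := le_trans (normc_ge0 x) xM.
elim: i => [|i IH]; first by rewrite !expr1 mul1r expr0 mulr1.
have -> : x ^+ i.+2 - y ^+ i.+2 = x * (x ^+ i.+1 - y ^+ i.+1) + (x - y) * y ^+ i.+1.
  by rewrite !exprS; ring.
apply: le_trans (le_normcD _ _) _; rewrite !Normc.normcM normcX.
have h1 := ler_pM (normc_ge0 x) (normc_ge0 _) xM IH.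
have h2 : nc (x - y) * nc y ^+ i.+1 <= nc (x - y) * M ^+ i.+1.
  by rewrite ler_wpM2l ?normc_ge0 // lerXn2r ?nnegrE ?normc_ge0.
apply: le_trans (lerD h1 h2) _; rewrite -[i.+2%:R]natr1 exprS le_eqVlt; apply/orP; left.
by apply/eqP; ring.
Qed.

(** With a_(i+1) <= 12^(i+1) and |x|, |y| <= 1/24, term i changes by at most 12 * 2^-i |x - y|; the
    geometric sum gives 24. *)
Lemma evalc_apery_log_lipschitz (x y : R[i]) : nc x <= 24%:R^-1 -> nc y <= 24%:R^-1 ->
  nc (evalc G x - evalc G y) <= 24%:R * nc (x - y).
Proof.
move=> hx hy; rewrite !evalc_apery_log -sumrB.
apply: le_trans (normc_sum _) _.
have half0 : 0 <= 2%:R^-1 :> R by rewrite invr_ge0.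
have := sum_exp_le2 n half0 (lexx _); rewrite -(ler_pM2l (ltr0n R 12)).
move=> /(ler_wpM2r (normc_ge0 (x - y))).
rewrite (_ : 12%:R * 2%:R * nc (x - y) = 24%:R * nc (x - y)); last by ring.
apply: le_trans; rewrite mulr_sumr mulr_suml; apply: ler_sum => i _.
rewrite -mulrBl -mulrBl Normc.normcM Normc.normcM Normc.normcV !normc_nat.
have i0 : i.+1%:R != 0 :> R by rewrite pnatr_eq0.
apply: (@le_trans _ _ (i.+1%:R * nc (x - y) * 24%:R^-1 ^+ i / i.+1%:R * 12%:R ^+ i.+1)).
  apply: ler_pM; rewrite ?mulr_ge0 ?invr_ge0 ?normc_ge0 //.
    by rewrite ler_wpM2r ?invr_ge0 // normc_subX_le.
  by rewrite -natrX ler_nat apery_le.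
rewrite le_eqVlt; apply/orP; left; apply/eqP.
rewrite (_ : 24%:R^-1 = 2%:R^-1 * 12%:R^-1 :> R); last by field.
rewrite exprMn exprS [12%:R^-1 ^+ i]exprVn; field.
by rewrite ?nat1r ?natr1 ?i0 ?expf_neq0 ?pnatr_eq0.
Qed.

Lemma evalc_polU (v : R[i]) :
  evalc (polU R) v = 1 - 2%:R * v + 4%:R * v ^+ 2 - 3%:R * v ^+ 3 + v ^+ 4.
Proof.
by rewrite /polU !(evalcXn, evalcX, evalc1, evalc_nat, evalcB, evalcD, evalcM).
Qed.

Lemma evalc_polD (v : R[i]) :
  evalc (polD R) v = 1 + 3%:R * v + 4%:R * v ^+ 2 + 2%:R * v ^+ 3 + v ^+ 4.
Proof.
by rewrite /polD !(evalcXn, evalcX, evalc1, evalc_nat, evalcB, evalcD, evalcM).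
Qed.

Section Point.
Variable v : R[i].
Hypothesis v_neq0 : v != 0.
Hypothesis v_small : nc v <= 200%:R^-1.
Local Notation Uv := (evalc (polU R) v).
Local Notation Dv := (evalc (polD R) v).

(** A crude bound that serves both 1 - D and 1 - U: four coefficients of modulus at most 4 and |v|
    <= 1/200 give 16/200. *)
Let normc_poly4_le (a b c d : R[i]) :
  nc a <= 4%:R -> nc b <= 4%:R -> nc c <= 4%:R -> nc d <= 4%:R ->
  nc (v * (a + b * v + c * v ^+ 2 + d * v ^+ 3)) <= 2%:R^-1.
Proof.
move=> ha hb hc hd; rewrite Normc.normcM.
have vX k : nc v ^+ k <= 1.
  by apply: exprn_ile1; [exact: normc_ge0|apply: le_trans v_small _; lra].
have hX (x : R[i]) k : nc x <= 4%:R -> nc (x * v ^+ k) <= 4%:R.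
  move=> hx; rewrite Normc.normcM normcX -[4%:R]mulr1.
  by rewrite ler_pM ?exprn_ge0 ?normc_ge0.
have h1 := le_normcD (a + b * v + c * v ^+ 2) (d * v ^+ 3).
have h2 := le_normcD (a + b * v) (c * v ^+ 2).
have h3 := le_normcD a (b * v).
have h4 := hX _ 1%N hb; have h5 := hX _ 2%N hc; have h6 := hX _ 3%N hd; rewrite expr1 in h4.
have h7 : nc (a + b * v + c * v ^+ 2 + d * v ^+ 3) <= 16%:R by lra.
apply: le_trans (ler_pM (normc_ge0 _) (normc_ge0 _) v_small h7) _; lra.
Qed.

Lemma normc_1subD : nc (1 - Dv) <= 2%:R^-1.
Proof.
rewrite evalc_polD -normcN.
rewrite (_ : - _ = v * (3%:R + 4%:R * v + 2%:R * v ^+ 2 + 1 * v ^+ 3)); last by ring.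
by apply: normc_poly4_le; rewrite ?Normc.normc1 ?normc_nat; lra.
Qed.

Lemma normc_1subU : nc (1 - Uv) <= 2%:R^-1.
Proof.
rewrite evalc_polU.
rewrite (_ : 1 - _ = v * (2%:R + (- 4%:R) * v + 3%:R * v ^+ 2 + (- 1) * v ^+ 3)); last by ring.
by apply: normc_poly4_le; rewrite ?normcN ?Normc.normc1 ?normc_nat; lra.
Qed.

Lemma YfunE : Yfun v = v * Uv / Dv.
Proof. by rewrite /Yfun evalc_polU evalc_polD. Qed.

(** Four errors of at most [h] each: the expansion of r at Y, the logarithms of U and of D in ln |Y|
    = ln |v| + ln |U| - ln |D|, and the passage from Y to its truncation inside G. *)
Lemma r_Yfun_expansion :
  `|r (Yfun v) - (- ln (nc v) - Re (evalc (polP R n) v) - 5%:R^-1 * Re (evalc G (v ^+ 5)))|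
  <= 4%:R * h.
Proof.
have D2 := normc_inv_le2 normc_1subD; have U2 := normc_inv_le2 normc_1subU.
have D_gt0 : 0 < nc Dv by apply: lt_le_trans D2; rewrite invr_gt0.
have U_gt0 : 0 < nc Uv by apply: lt_le_trans U2; rewrite invr_gt0.
have nz (w : R[i]) : 0 < nc w -> w != 0.
  by move=> w_gt0; apply/eqP => w0; move: w_gt0; rewrite w0 Normc.normc0 ltxx.
have D_neq0 := nz _ D_gt0; have U_neq0 := nz _ U_gt0.
have v_gt0 := normc_gt0 v_neq0.
have ncY : nc (Yfun v) = nc v * nc Uv / nc Dv.
  by rewrite YfunE !Normc.normcM Normc.normcV.
have U_le : nc Uv <= 3%:R / 2%:R.
  have := normcB 1 (1 - Uv); rewrite subKr Normc.normc1.
  have := normc_1subU; lra.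
have Y_le : nc (Yfun v) <= 3%:R / 200%:R.
  rewrite ncY ler_pdivrMr //.
  have := ler_pM (normc_ge0 v) (normc_ge0 Uv) v_small U_le; lra.
set Yn := evalc (polY R n) v.
(* [polE n] inverts D only up to (1 - D)^n, hence this relative error in the truncated Y. *)
have YnE : Yn = Yfun v * (1 - (1 - Dv) ^+ n).
  have e : Dv * evalc (polE R n) v = 1 - (1 - Dv) ^+ n.
    by rewrite -evalcM polDE evalcB evalc_exp evalcB !evalc1.
  rewrite -e YfunE /Yn /polY !evalcM evalcX; field.
  exact: D_neq0.
have hD : nc ((1 - Dv) ^+ n) <= h.
  by rewrite normcX lerXn2r ?nnegrE ?normc_ge0 ?invr_ge0 // normc_1subD.
have h_le1 : h <= 1 by apply: exprn_ile1; rewrite ?invr_ge0 // invf_le1 ?ler1n ?ltr0n.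
have dY : nc (Yfun v - Yn) <= 3%:R / 200%:R * h.
  have -> : Yfun v - Yn = Yfun v * (1 - Dv) ^+ n by rewrite YnE; ring.
  by rewrite Normc.normcM ler_pM ?normc_ge0.
have Y24 : nc (Yfun v) <= 24%:R^-1 by lra.
have Yn24 : nc Yn <= 24%:R^-1.
  have := normcB (Yfun v) (Yfun v - Yn); rewrite subKr; lra.
have e1 := r_expansion (nz _ (_ : 0 < nc (Yfun v))) Y24 n.
have {e1}e1 : `|r (Yfun v) - (- ln (nc (Yfun v)) - Re (evalc G (Yfun v)))| <= h.
  by rewrite -hS; apply: e1; rewrite ncY divr_gt0 ?mulr_gt0.
have e2 : `|ln (nc Uv) + Re (evalc (nlog_1sub n (1 - polU R)) v)| <= h.
  have := ln_normc_1sub n normc_1subU; rewrite subKr => e.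
  rewrite evalc_nlog_1sub evalcB evalc1.
  apply: le_trans e _; rewrite -hS ler_wpM2l // lerXn2r ?nnegrE ?normc_ge0 ?invr_ge0 //.
  exact: normc_1subU.
have e3 : `|ln (nc Dv) + Re (evalc (nlog_1sub n (1 - polD R)) v)| <= h.
  have := ln_normc_1sub n normc_1subD; rewrite subKr => e.
  rewrite evalc_nlog_1sub evalcB evalc1.
  apply: le_trans e _; rewrite -hS ler_wpM2l // lerXn2r ?nnegrE ?normc_ge0 ?invr_ge0 //.
  exact: normc_1subD.
have e4 : `|Re (evalc G (Yfun v)) - Re (evalc G Yn)| <= h.
  rewrite -ReB; apply: le_trans (normr_Re_le _) _.
  apply: le_trans (evalc_apery_log_lipschitz Y24 Yn24) _; move: dY h_ge0; rewrite -/Yn; lra.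
have lnY : ln (nc (Yfun v)) = ln (nc v) + ln (nc Uv) - ln (nc Dv).
  by rewrite ncY ln_div ?posrE ?mulr_gt0 // lnM.
have PnE : Re (evalc (polP R n) v) = Re (evalc G Yn)
    - Re (evalc (nlog_1sub n (1 - polU R)) v) + Re (evalc (nlog_1sub n (1 - polD R)) v)
    - 5%:R^-1 * Re (evalc G (v ^+ 5)).
  rewrite -ReB -ReD -ReZ -ReB; congr (Re _).
  rewrite /Yn -!evalc_comp /polP.
  by rewrite -(evalcXn 5) -evalc_comp evalcB evalcZ evalcD evalcB.
move: e1 e2 e3 e4; rewrite PnE lnY !ler_norml => /andP[? ?] /andP[? ?] /andP[? ?] /andP[? ?].
by apply/andP; split; lra.
Qed.

End Point.
End Assembly.

Unset Implicit Arguments.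
Set Strict Implicit.
Set Printing Implicit Defensive.

Theorem mainTheorem9 (R : realType) :
  exists eps : R, 0 < eps /\
    forall u : R[i], 0 < Normc.normc u < eps ->
      r (u ^+ 5) = \sum_(j < 5) r (Yfun (zeta5 R ^+ j * u)).
Proof.
(* The radius serves [r_Yfun_expansion], which asks for |v| <= 1/200, and [fifth_section_bound],
   which asks for |u| <= rho / 2 at rho = 1/100. *)
exists 200%:R^-1; split; first by rewrite invr_gt0.
move=> u /andP[u_gt0 u_small].
have u_neq0 : u != 0 by apply/eqP => u0; move: u_gt0; rewrite u0 Normc.normc0 ltxx.
set v := fun j : 'I_5 => zeta5 R ^+ j * u.
have nv j : Normc.normc (v j) = Normc.normc u.
  by rewrite /v Normc.normcM normc_zeta5X mul1r.
have v5 j : v j ^+ 5 = u ^+ 5.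
  by rewrite /v exprMn exprAC zeta5_exp5 expr1n mul1r.
have v_neq0 j : v j != 0 by rewrite mulf_neq0 // expf_neq0 // expi2pi_neq0.
set X := \sum_(j < 5) _.
(* 41 = 1 + 20 + 20 adds the errors in [e0], [eP] and [eX]. A positive distance is refuted by an n
   that makes the bound at most half of it, whence 82. *)
suff bound n : `|r (u ^+ 5) - X| <= 41%:R * 2%:R^-1 ^+ n.
  apply/eqP; rewrite -subr_eq0 -normr_le0 leNgt; apply/negP => X_gt0.
  have [N hN] := @half_pow_le R (`|r (u ^+ 5) - X| / 82%:R) (divr_gt0 X_gt0 (ltr0n _ 82)).
  have := hN _ (leqnn N); have := bound N; lra.
set h := 2%:R^-1 ^+ n.
have e0 : `|r (u ^+ 5) - (- (5%:R * ln (Normc.normc u)) - Re (evalc (apery_log_poly R n) (u ^+ 5)))| <= h.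
  have u5 : Normc.normc (u ^+ 5) <= 24%:R^-1.
    rewrite normcX; apply: (@le_trans _ _ (Normc.normc u ^+ 1)); last by rewrite expr1; lra.
    by rewrite ler_wiXn2l ?normc_ge0 //; lra.
  have := r_expansion (expf_neq0 5 u_neq0) u5 n.
  rewrite [2%:R * _](_ : _ = h); last by rewrite exprS mulrA mulfV ?mul1r ?pnatr_eq0.
  by rewrite normcX lnXn // -[ln _ *+ 5]mulr_natl.
have ej (j : 'I_5) : `|r (Yfun (v j)) - (- ln (Normc.normc u) - Re (evalc (polP R n) (v j))
    - 5%:R^-1 * Re (evalc (apery_log_poly R n) (u ^+ 5)))| <= 4%:R * h.
  rewrite -(nv j) -(v5 j); apply: r_Yfun_expansion => //.
  by rewrite nv ltW.
(* 20 is the number 5 of roots times the norm bound 4 of [wnorm_polP]. *)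
have eP : `|Re (\sum_(j < 5) evalc (polP R n) (v j))| <= 20%:R * h.
  apply: le_trans (normr_Re_le _) _.
  have rho0 : 0 <= 100%:R^-1 :> R by rewrite invr_ge0.
  have u_rho : Normc.normc u <= 100%:R^-1 / 2%:R by lra.
  apply: le_trans (fifth_section_bound (@polP_section R n) rho0 u_rho) _.
  have := ler_wpM2l (_ : 0 <= 5%:R * h) (wnorm_polP R n).
  rewrite (_ : 20%:R * h = 5%:R * h * 4%:R); last by ring.
  by apply; rewrite mulr_ge0 ?exprn_ge0 ?invr_ge0.
set g := Re (evalc (apery_log_poly R n) (u ^+ 5)) in e0 ej.
have eX : `|X - (- (5%:R * ln (Normc.normc u)) - Re (\sum_(j < 5) evalc (polP R n) (v j)) - g)|
    <= 20%:R * h.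
  (* Five copies of - ln |u| and of - g / 5 rebuild the expansion of r(u^5), leaving only the sum of
     P over the roots. *)
  have -> : - (5%:R * ln (Normc.normc u)) - Re (\sum_(j < 5) evalc (polP R n) (v j)) - g =
      \sum_(j < 5) (- ln (Normc.normc u) - Re (evalc (polP R n) (v j)) - 5%:R^-1 * g).
    by rewrite Re_sum !sumrB !sumr_const card_ord; field.
  rewrite /X -sumrB; apply: le_trans (ler_norm_sum _ _ _) _.
  apply: le_trans (ler_sum _ (fun j _ => ej j)) _.
  by rewrite sumr_const card_ord le_eqVlt; apply/orP; left; apply/eqP; ring.
move: eP e0 eX; rewrite !ler_norml => /andP[? ?] /andP[? ?] /andP[? ?].
by apply/andP; split; lra.
Qed.
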